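(* Let $1<\alpha\le 2$. Let $f_0\in D_f^{\beta}$, $g_0\in D_g^{\varepsilon}$ be positive spectral densities satisfying the minimality condition $\int_{-\pi}^{\pi}(f_0(\theta)+g_0(\theta))^{-1/(\alpha-1)}d\theta<\infty$, and let $h^0=h(f_0,g_0)$ be determined by $$\bigl(A(e^{i\theta})-h^0(\theta)\bigr)^{<\alpha-1>}f_0(\theta)-\bigl(h^0(\theta)\bigr)^{<\alpha-1>}g_0(\theta)=\overline{C^0(e^{i\theta})},\quad C^0(e^{i\theta})=\sum_{j=0}^\infty c_je^{ij\theta},\tag{1}$$ $$\int_{-\pi}^{\pi}e^{-i\theta k}h^0(\theta)\,d\theta=0,\quad k=0,1,\dots .\tag{2}$$ Suppose that the functions $|A(e^{i\theta})-h^0(\theta)|^\alpha$ and $|h^0(\theta)|^\alpha$ are bounded. Then $f_0$ and $g_0$ are the least favorable spectral densities in the class $D=D_f^\beta\times D_g^\varepsilon$ for the optimal linear estimation of the functional $A\xi=\sum_{j=0}^\infty a_j\xi_j$ (from observations of $\xi_k+\eta_k$, $k=-1,-2,\dots$) if they satisfy the equations $$|A(e^{i\theta})-h^0(\theta)|^\alpha=\gamma_1\,(f_0(\theta))^{\beta-1},\qquad |h^0(\theta)|^\alpha=\varphi_1(\theta)+\gamma_2,$$ where $\gamma_1,\gamma_2$ are constants (Lagrange multipliers determined from $\int_{-\pi}^\pi f_0^\beta d\theta=P_1$, $\int_{-\pi}^\pi g_0\,d\theta=P_2$), $\varphi_1(\theta)\le0$, and $\varphi_1(\theta)=0$ whenever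 $g_0(\theta)>(1-\varepsilon)g_1(\theta)$, and if they give a solution to the optimization problem $$\max_{(f,g)\in D}\Delta(h^0;f,g)=\Delta(h^0;f_0,g_0).$$ In this case the minimax-robust spectral characteristic of the optimal estimate of $A\xi$ is $h^0=h(f_0,g_0)$, determined by (1), (2).
   Context: For a complex number $z$ and $b>0$, $z^{<b>}=|z|^{b-1}\bar z$. The complex coefficients $a_j$ satisfy $\sum_j|a_j|<\infty$, $\sum_j(j+1)|a_j|^2<\infty$, and $A(e^{i\theta})=\sum_{j\ge0}a_je^{ij\theta}$. The sequences $\xi_k=\int_{-\pi}^{\pi}e^{ik\theta}dZ^\xi(\theta)$ and $\eta_k=\int_{-\pi}^{\pi}e^{ik\theta}dZ^\eta(\theta)$, $k\in\mathbb Z$, are mutually independent harmonizable symmetric $\alpha$-stable sequences, where $Z^\xi,Z^\eta$ are symmetric $\alpha$-stable processes with independent increments with spectral measures $f(\theta)d\theta$, $g(\theta)d\theta$ (spectral densities: nonnegative integrable functions on $[-\pi,\pi]$). $L^\alpha_-(f+g)$ is the closed linear subspace generated by $e^{ik\theta}$, $k=-1,-2,\dots$, in $L^\alpha$ on $[-\pi,\pi]$ with weight $f+g$. A linear estimate of $A\xi$ from $\xi_k+\eta_k$, $k\le-1$, is $\int h\,(dZ^\xi+dZ^\eta)$ with spectral characteristic $h\in L^\alpha_-(f+g)$, and its error is $$\Delta(h;f,g)=\int_{-\pi}^{\pi}|A(e^{i\theta})-h(\theta)|^\alpha f(\theta)\,d\theta+\int_{-\pi}^{\pi}|h(\theta)|^\alpha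 g(\theta)\,d\theta .$$ $h(f,g)$ denotes the spectral characteristic of the optimal estimate, i.e. the minimizer of $\Delta(\cdot;f,g)$ over $L^\alpha_-(f+g)$. Classes of admissible densities: $D_f^\beta=\{f:\int_{-\pi}^\pi (f(\theta))^\beta d\theta=P_1\}$; $D_g^\varepsilon=\{g: g(\theta)=(1-\varepsilon)g_1(\theta)+\varepsilon w(\theta),\ \int_{-\pi}^{\pi}g(\theta)d\theta=P_2\}$, where $\beta$, $P_1$, $P_2$, $\varepsilon\in(0,1)$ and the spectral density $g_1$ are fixed and known, and $w$ is an arbitrary (unknown) spectral density. For a class $D$: $(f_0,g_0)\in D$ is least favorable if $\Delta(h(f_0,g_0);f_0,g_0)=\max_{(f,g)\in D}\Delta(h(f,g);f,g)$. A spectral characteristic $h^0$ is minimax (robust) if $h^0\in H_D=\bigcap_{(f,g)\in D}L^\alpha_-(f+g)$ and $\min_{h\in H_D}\max_{(f,g)\in D}\Delta(h;f,g)=\max_{(f,g)\in D}\Delta(h^0;f,g)$. *)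

(* Defs.v *)
From HB Require Import structures.
From mathcomp Require Import all_boot all_order all_algebra.
From mathcomp Require Import all_classical all_reals all_analysis.
From mathcomp Require Import complex.
Set Implicit Arguments.
Unset Strict Implicit.
Unset Printing Implicit Defensive.
Import Order.TTheory GRing.Theory Num.Theory.
Import numFieldNormedType.Exports.
Local Open Scope classical_set_scope.
Local Open Scope ring_scope.
Local Open Scope complex_scope.
Import Normc.

Section ComplexFunctions.
Variable R : realType.
Implicit Types (u c : nat -> R[i]) (h C : R -> R[i]).

Definition circle : set R := `[- pi, pi]%classic.

Definition expi (x : R) : R[i] := cos x +i* sin x.

(* z^{<b>} = |z|^(b-1) * conj z; its value at z = 0 is 0 for every b, because
   0 `^ (b - 1) is finite. *)
Definition signed_pow (z : R[i]) (b : R) : R[i] :=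
  (normc z `^ (b - 1))%:C * conjc z.

(* Sum of a convergent complex series, taken componentwise. *)
Definition cseries_sum u : R[i] :=
  limn (series (fun j => complex.Re (u j))) +i*
  limn (series (fun j => complex.Im (u j))).

Definition boundary_fun (a : nat -> R[i]) (theta : R) : R[i] :=
  cseries_sum (fun j => a j * expi (j%:R * theta)).

Definition cmeasurable h :=
  measurable_fun circle (fun x => complex.Re (h x)) /\
  measurable_fun circle (fun x => complex.Im (h x)).

Definition cintegrable h :=
  (@lebesgue_measure R).-integrable circle (fun x => (complex.Re (h x))%:E) /\
  (@lebesgue_measure R).-integrable circle (fun x => (complex.Im (h x))%:E).

Definition cintegral h : R[i] :=
  (\int[@lebesgue_measure R]_(x in circle) complex.Re (h x)) +i*
  (\int[@lebesgue_measure R]_(x in circle) complex.Im (h x)).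

Definition fourier_coef C (k : int) : R[i] :=
  ((2 * pi)^-1)%:C * cintegral (fun x => C x * expi (- (k%:~R * x))).

(* C(theta) = \sum_(j >= 0) c_j e^(i j theta), understood as the Fourier series
   of the integrable function C: no mode of pointwise convergence is assumed. *)
Definition analytic_series C c :=
  [/\ cintegrable C,
      (forall j : nat, fourier_coef C j%:Z = c j) &
      (forall j : nat, fourier_coef C (- (j.+1)%:Z) = 0)].

End ComplexFunctions.

Arguments circle R : clear implicits.

Section Densities.
Variable R : realType.
Implicit Types f g w : R -> R.

Definition spectral_density f :=
  (forall x, circle R x -> 0 <= f x) /\
  (@lebesgue_measure R).-integrable (circle R) (EFin \o f).

(* The power x^b of x >= 0 with 0^b = +oo for b < 0 (powR gives 0 there). *)
Definition epow (x b : R) : \bar R :=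
  if (x == 0) && (b < 0) then +oo%E else (x `^ b)%:E.

Definition class_power (beta P1 : R) f :=
  spectral_density f /\
  (\int[@lebesgue_measure R]_(x in circle R) epow (f x) beta = P1%:E)%E.

Definition class_contaminated (eps P2 : R) (g1 : R -> R) g :=
  [/\ spectral_density g,
      (exists2 w, spectral_density w &
         forall x, circle R x -> g x = (1 - eps) * g1 x + eps * w x) &
      (\int[@lebesgue_measure R]_(x in circle R) (g x)%:E = P2%:E)%E].

End Densities.

Section Estimation.
Variables (R : realType) (alpha : R).
Implicit Types (f g w : R -> R) (h A : R -> R[i]).

Definition weighted_norm w h : \bar R :=
  poweR (\int[@lebesgue_measure R]_(x in circle R)
           (normc (h x) `^ alpha * w x)%:E)%E alpha^-1.

(* Finite linear combination of e^(i k theta), k = -1, ..., -n. *)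
Definition neg_trig (n : nat) (c : nat -> R[i]) (x : R) : R[i] :=
  \sum_(k < n) c k * expi (- ((k.+1)%:R * x)).

(* Closure in L^alpha(w) of the linear span of e^(i k theta), k <= -1;
   elements are represented by measurable functions on [-pi, pi]. *)
Definition Lminus w : set (R -> R[i]) :=
  [set h | [/\ cmeasurable h, (weighted_norm w h < +oo)%E &
     forall e : R, 0 < e -> exists n c,
       (weighted_norm w (fun x => h x - neg_trig n c x)%R < e%:E)%E]].

Definition error A h f g : \bar R :=
  (\int[@lebesgue_measure R]_(x in circle R)
      (normc (A x - h x) `^ alpha * f x)%:E +
   \int[@lebesgue_measure R]_(x in circle R)
      (normc (h x) `^ alpha * g x)%:E)%E.

(* h = h(f, g). A relation, because a spectral characteristic is only
   determined up to (f + g)-null sets. *)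
Definition optimal A f g h :=
  Lminus (fun x => f x + g x) h /\
  forall h', Lminus (fun x => f x + g x) h' ->
    (error A h f g <= error A h' f g)%E.

Definition is_max (E : set (\bar R)) (m : \bar R) := E m /\ ubound E m.

Definition least_favorable A (D : set ((R -> R) * (R -> R))) f0 g0 :=
  D (f0, g0) /\
  exists2 h0, optimal A f0 g0 h0 &
    is_max [set e | exists f g h,
              [/\ D (f, g), optimal A f g h & e = error A h f g]]
           (error A h0 f0 g0).

Definition H_class (D : set ((R -> R) * (R -> R))) : set (R -> R[i]) :=
  [set h | forall f g, D (f, g) -> Lminus (fun x => f x + g x) h].

Definition errors A (D : set ((R -> R) * (R -> R))) h : set (\bar R) :=
  [set error A h p.1 p.2 | p in D].

(* The maximum over D is attained at the minimax h0; for a competing h it is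
   read as a supremum. *)
Definition minimax A (D : set ((R -> R) * (R -> R))) h0 :=
  H_class D h0 /\
  exists2 m, is_max (errors A D h0) m &
    forall h, H_class D h -> (m <= ereal_sup (errors A D h))%E.

End Estimation.

(* Main.v *)
(** Optimality of [h0] is orthogonality: by convexity of [|z|^alpha], the error at
    a competitor [h] exceeds that at [h0] by at least
    [alpha * Re (\int (h0 - h) * conj C0)] (with the pairing taken from equation
    (1)), and this vanishes because [conj C0] annihilates every [e^(i k theta)]
    with [k <= -1], hence, being dominated by [f0 + g0], all of
    [L^alpha_-(f0 + g0)].

    The point that needs work is that [h0] lies in [L^alpha_-(w)] for every
    integrable weight [w], not only for [f0 + g0].  This uses boundedness of [h0]:
    by (2) its Fejer means are combinations of negative frequencies, they are
    uniformly bounded and converge to [h0] in [L^1], and a truncation of [w]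
    turns this into convergence in [L^alpha(w)].

    The least favorable and minimax properties are then the saddle-point
    inequalities [Delta(h(f,g);f,g) <= Delta(h0;f,g) <= Delta(h0;f0,g0)]. *)
Require Import Defs.
From HB Require Import structures.
From mathcomp Require Import all_boot all_order all_algebra.
From mathcomp Require Import all_classical all_reals all_analysis.
From mathcomp Require Import complex.
From mathcomp Require Import measurable_realfun ring lra.
Import Order.TTheory GRing.Theory Num.Theory.
Import numFieldNormedType.Exports.
Local Open Scope classical_set_scope.
Local Open Scope ring_scope.
Local Open Scope complex_scope.
Import Normc.
Set Implicit Arguments.
Unset Strict Implicit.
Unset Printing Implicit Defensive.

(** The sum [f + g] of a pair in [D] need not be dominated by [f0 + g0], so membership of [h0]
    cannot be carried from one weight to another and must come from [h0] itself. Fejer means are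
    chosen because their kernel is nonnegative with integral one: positivity yields both the sup
    bound and the [L^1] contraction. A truncated weight asks for just these two. Above the
    truncation level the sup bound meets a small weight; below it, [d^alpha <= D^(alpha-1) * d] for
    [0 <= d <= D] reduces the power [alpha] to the first power. Orthogonality passes to the closure
    through [t <= d + d^(1-alpha) * t^alpha], valid for every [d > 0]: with [d] the accuracy of
    approximation in [L^alpha(w)], both terms are of order [d]. The domination of [C0] that this
    requires comes from [|z|^(alpha-1) <= 1 + |z|^alpha] and the two boundedness hypotheses. *)

Section ComplexModulus.
Variable R : realType.
Implicit Types z w : R[i].

Lemma normc_ge0 z : 0 <= normc z.
Proof. by case: z => a b; exact: sqrtr_ge0. Qed.

Lemma normcD z w : normc (z + w) <= normc z + normc w.
Proof. exact: le_normcD. Qed.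

Lemma normc_distrC z w : normc (z - w) = normc (w - z).
Proof. by rewrite -opprB normcN. Qed.

Lemma normc_real (r : R) : normc r%:C = `|r|.
Proof. by rewrite /= expr0n /= addr0 sqrtr_sqr. Qed.

Lemma normc_conj z : normc (conjc z) = normc z.
Proof. by case: z => a b /=; rewrite sqrrN. Qed.

Lemma normc_Re z : `|complex.Re z| <= normc z.
Proof.
by case: z => a b /=; rewrite -sqrtr_sqr ler_wsqrtr// lerDl sqr_ge0.
Qed.

Lemma normc_Im z : `|complex.Im z| <= normc z.
Proof.
by case: z => a b /=; rewrite -sqrtr_sqr ler_wsqrtr// lerDr sqr_ge0.
Qed.

Lemma normc_le z : normc z <= `|complex.Re z| + `|complex.Im z|.
Proof.
have -> : z = (complex.Re z)%:C + 'i * (complex.Im z)%:C by rewrite {1}(complexE z).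
apply: le_trans (normcD _ _) _.
rewrite normcM !normc_real /= expr0n expr1n add0r sqrtr1 mul1r.
by rewrite !(mul0r,mul1r,addr0,add0r,subr0,oppr0).
Qed.

Lemma normc_sqr z : (normc z ^+ 2)%:C = z * conjc z.
Proof.
case: z => a b; rewrite /= sqr_sqrtr ?addr_ge0 ?sqr_ge0//.
by simpc; congr (_ +i* _); rewrite mulrC addNr.
Qed.

Lemma expiD (x y : R) : expi (x + y) = expi x * expi y.
Proof.
rewrite /expi; simpc; rewrite cosD sinD; congr (_ +i* _).
by rewrite addrC.
Qed.

Lemma expi0 : expi 0 = 1 :> R[i].
Proof. by rewrite /expi cos0 sin0. Qed.

Lemma conjc_expi (x : R) : conjc (expi x) = expi (- x).
Proof. by rewrite /expi /= cosN sinN. Qed.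

Lemma normc_expi (x : R) : normc (expi x) = 1.
Proof. by rewrite /= cos2Dsin2 sqrtr1. Qed.

Lemma ReD z w : complex.Re (z + w) = complex.Re z + complex.Re w.
Proof. by case: z => ? ?; case: w. Qed.

Lemma ImD z w : complex.Im (z + w) = complex.Im z + complex.Im w.
Proof. by case: z => ? ?; case: w. Qed.

Lemma ReM z w : complex.Re (z * w) =
  complex.Re z * complex.Re w - complex.Im z * complex.Im w.
Proof. by case: z => ? ?; case: w. Qed.

Lemma ImM z w : complex.Im (z * w) =
  complex.Re z * complex.Im w + complex.Im z * complex.Re w.
Proof. by case: z => ? ?; case: w => ? ? /=; rewrite addrC. Qed.

Lemma ReN z : complex.Re (- z) = - complex.Re z.
Proof. by case: z. Qed.

Lemma ImN z : complex.Im (- z) = - complex.Im z.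
Proof. by case: z. Qed.

End ComplexModulus.

(** * Componentwise integration of complex functions on the circle *)

Section ComplexIntegral.
Variable R : realType.
Implicit Types h k : R -> R[i].
Let mu := @lebesgue_measure R.

Lemma measurable_circle : measurable (circle R).
Proof. exact: measurable_itv. Qed.
(** Lebesgue measure lives on the alias [measurableTypeR R], so some side conditions ask for
    measurability there; the two statements are convertible. *)
Lemma measurableTypeR_circle : measurable (circle R : set (measurableTypeR R)).
Proof. exact: measurable_circle. Qed.
Hint Resolve measurable_circle measurableTypeR_circle : core.

Lemma lebesgue_measure_circle : mu (circle R) = (2 * pi)%:E.
Proof.
rewrite /mu /circle lebesgue_measure_itv /= lte_fin.
have p0 := pi_gt0 R.
rewrite ifT; last by lra.
by rewrite -EFinB opprK; congr EFin; lra.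
Qed.

Lemma lebesgue_measure_circle_lty : (mu (circle R) < +oo)%E.
Proof. by rewrite lebesgue_measure_circle ltry. Qed.

Lemma ae_imply (P Q : R -> Prop) : (forall x, P x -> Q x) ->
  (\forall x \ae mu, P x) -> \forall x \ae mu, Q x.
Proof.
move=> PQ; exact: (@filterS _ _ (ae_filter_ringOfSetsType
  (lebesgue_measure : {measure set (measurableTypeR R) -> \bar R})) _ _ PQ).
Qed.

Lemma ae_imply2 (P Q S : R -> Prop) : (forall x, P x -> Q x -> S x) ->
  (\forall x \ae mu, P x) -> (\forall x \ae mu, Q x) -> \forall x \ae mu, S x.
Proof.
move=> PQS; exact: (@filterS2 _ _ (ae_filter_ringOfSetsType
  (lebesgue_measure : {measure set (measurableTypeR R) -> \bar R})) _ _ _ PQS).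
Qed.

Lemma Rintegral_circle_cst (r : R) :
  \int[mu]_(x in circle R) r = r * (2 * pi).
Proof.
transitivity (r * fine (mu (circle R))); first exact: Rintegral_cst.
by rewrite lebesgue_measure_circle.
Qed.

Lemma cintegrableD h k :
  cintegrable h -> cintegrable k -> cintegrable (fun x => h x + k x).
Proof.
move=> [h1 h2] [k1 k2]; split.
- by apply: eq_integrable (integrableD _ h1 k1) => // x _; rewrite ReD.
- by apply: eq_integrable (integrableD _ h2 k2) => // x _; rewrite ImD.
Qed.

Lemma cintegralD h k : cintegrable h -> cintegrable k ->
  cintegral (fun x => h x + k x) = cintegral h + cintegral k.
Proof.
move=> [h1 h2] [k1 k2]; rewrite /cintegral; simpc; congr (_ +i* _).
- by rewrite -RintegralD//; apply: eq_Rintegral => x _; rewrite ReD.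
- by rewrite -RintegralD//; apply: eq_Rintegral => x _; rewrite ImD.
Qed.

Lemma cintegrableZ (c : R[i]) h :
  cintegrable h -> cintegrable (fun x => c * h x).
Proof.
move=> [h1 h2]; split.
- apply: eq_integrable (integrableB _ (integrableZl _ (complex.Re c) h1)
    (integrableZl _ (complex.Im c) h2)) => // x _.
  by rewrite ReM.
- apply: eq_integrable (integrableD _ (integrableZl _ (complex.Re c) h2)
    (integrableZl _ (complex.Im c) h1)) => // x _.
  by rewrite ImM.
Qed.

Lemma cintegralZ (c : R[i]) h : cintegrable h ->
  cintegral (fun x => c * h x) = c * cintegral h.
Proof.
move=> [h1 h2].
have H (f : R -> R) r : mu.-integrable (circle R) (fun x => (f x)%:E) ->
    mu.-integrable (circle R) (EFin \o (fun x => r * f x)).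
  by move=> hf; exact: (integrableZl _ r hf).
rewrite {2}/cintegral [c in RHS](_ : _ = complex.Re c +i* complex.Im c).
  simpc; congr (_ +i* _).
  - rewrite -!RintegralZl// -RintegralB//; try exact: H.
    by apply: eq_Rintegral => x _; rewrite ReM.
  - rewrite -!RintegralZl// -RintegralD//; try exact: H.
    by apply: eq_Rintegral => x _; rewrite ImM addrC.
by case: c.
Qed.

Lemma cintegrable0 : cintegrable (fun=> 0 : R[i]).
Proof. by split; exact: integrable0. Qed.

Lemma cintegral0 : cintegral (fun=> 0 : R[i]) = 0.
Proof.
rewrite /cintegral /=.
by rewrite !Rintegral_circle_cst !mul0r.
Qed.

Lemma cintegrable_sum (I : Type) (s : seq I) (P : pred I) (h : I -> R -> R[i]) :
  (forall i, cintegrable (h i)) ->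
  cintegrable (fun x => \sum_(i <- s | P i) h i x).
Proof.
move=> hi; elim: s => [|i s ih].
  by under eq_fun do rewrite big_nil; exact: cintegrable0.
under eq_fun do rewrite big_cons.
by case: (P i) => //; exact: cintegrableD.
Qed.

Lemma cintegral_sum (I : Type) (s : seq I) (P : pred I) (h : I -> R -> R[i]) :
  (forall i, cintegrable (h i)) ->
  cintegral (fun x => \sum_(i <- s | P i) h i x) =
  \sum_(i <- s | P i) cintegral (h i).
Proof.
move=> hi; elim: s => [|i s ih].
  by under eq_fun do rewrite big_nil; rewrite big_nil cintegral0.
under eq_fun do rewrite big_cons.
rewrite big_cons; case: (P i) => //.
by rewrite cintegralD ?ih//; exact: cintegrable_sum.
Qed.

Lemma measurable_cos : measurable_fun [set: R] (@cos R).
Proof. by apply: continuous_measurable_fun; exact: continuous_cos. Qed.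

Lemma measurable_sin : measurable_fun [set: R] (@sin R).
Proof. by apply: continuous_measurable_fun; exact: continuous_sin. Qed.

Lemma bounded_integrable (B : R) (f : R -> R) :
  measurable_fun (circle R) f -> (forall x, circle R x -> `|f x| <= B) ->
  mu.-integrable (circle R) (EFin \o f).
Proof.
move=> mf fB; apply: measurable_bounded_integrable => //.
  exact: lebesgue_measure_circle_lty.
exists B; split; first exact: num_real.
by move=> y By x /fB /le_trans; apply; exact: ltW.
Qed.

Lemma cintegrable_expiM (r : R) h :
  cintegrable h -> cintegrable (fun x => expi (r * x) * h x).
Proof.
move=> [h1 h2].
have B (f : R -> R) : (forall x, `|f x| <= 1) -> [bounded f x | x in circle R].
  by move=> fB; exists 1; split=> // y y1 x _; apply: le_trans (fB x) (ltW y1).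
have mc : measurable_fun (circle R) (fun x => cos (r * x)).
  apply: (measurableT_comp measurable_cos); exact: measurable_funM.
have ms : measurable_fun (circle R) (fun x => sin (r * x)).
  apply: (measurableT_comp measurable_sin); exact: measurable_funM.
have Bc : [bounded cos (r * x) | x in circle R].
  by apply: B => x; rewrite ler_norml cos_geN1 cos_le1.
have Bs : [bounded sin (r * x) | x in circle R].
  by apply: B => x; rewrite ler_norml sin_geN1 sin_le1.
split.
- have A1 := integrableMr (mu := mu) measurable_circle mc Bc h1.
  have A2 := integrableMr (mu := mu) measurable_circle ms Bs h2.
  apply: eq_integrable (integrableB _ A1 A2) => // x _.
  by rewrite ReM.
- have A1 := integrableMr (mu := mu) measurable_circle mc Bc h2.
  have A2 := integrableMr (mu := mu) measurable_circle ms Bs h1.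
  apply: eq_integrable (integrableD _ A1 A2) => // x _.
  by rewrite ImM.
Qed.

Lemma cintegrable_expi (r : R) : cintegrable (fun x => expi (r * x)).
Proof.
under eq_fun do rewrite -[expi _]mulr1.
apply: cintegrable_expiM; split => /=.
- by apply: (bounded_integrable (B := 1)) => // x _; rewrite normr1.
- exact: integrable0.
Qed.

End ComplexIntegral.
#[export] Hint Extern 0 (measurable (circle _)) => exact: measurable_circle : core.

(** * The Fejer kernel *)

Section FejerKernel.
Variable R : realType.
Implicit Types (x y t : R) (n : nat).
Let mu := @lebesgue_measure R.

Lemma Rintegral_circle_derive (f F : R -> R) :
  continuous f -> (forall x, is_derive x 1 F (f x)) ->
  \int[mu]_(x in circle R) f x = F pi - F (- pi).
Proof.
move=> cf dF; have p0 := pi_gt0 R.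
have dF' x : derivable F x 1 by have := dF x; case.
have cF : continuous F.
  by move=> x; apply: differentiable_continuous; exact/derivable1_diffP.
rewrite /Rintegral /circle (@continuous_FTC2 _ f F) -?EFinB //.
- by lra.
- exact: continuous_subspaceT.
- split => //.
  + exact: cvg_at_right_filter (cF _).
  + exact: cvg_at_left_filter (cF _).
- by move=> x _; rewrite derive1E; have := dF x; case.
Qed.

Lemma sin_natMpi n : sin (n%:R * pi) = 0 :> R.
Proof.
elim: n => [|n ih]; first by rewrite mul0r sin0.
by rewrite -natr1 mulrDl mul1r sinDpi ih oppr0.
Qed.

(** Orthogonality of characters, with the frequency written as a difference of naturals because that
    is how it arises in the double sum of the kernel. For [j != k] the primitives [sin (r x) / r]
    and [- cos (r x) / r] take equal values at both ends: [sin (r pi) = 0], and [cos] is even. *)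
Lemma cintegral_expi (j k : nat) :
  cintegral (fun x : R => expi ((j%:R - k%:R) * x)) = ((j == k)%:R * (2 * pi))%:C.
Proof.
have [<-|jk] := eqVneq j k.
  have -> : (fun x : R => expi ((j%:R - j%:R) * x)) = fun=> 1.
    by apply/funext => x; rewrite subrr mul0r expi0.
  by rewrite mul1r /cintegral /= !Rintegral_circle_cst mul0r mul1r.
rewrite mul0r; set r := j%:R - k%:R.
have r0 : r != 0 by rewrite subr_eq0 eqr_nat.
have sr : sin (r * pi) = 0 by rewrite mulrBl sinB !sin_natMpi mul0r mulr0 subrr.
have crM : continuous (fun x : R => r * x).
  by move=> x; apply: cvgM; [exact: cvg_cst|exact: cvg_id].
have dr x : is_derive x 1 (fun y : R => r * y) r.
  have := @is_deriveZ _ _ _ id r x 1 1 _; rewrite scaler1; exact.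
have dsin x : is_derive x 1 (fun y : R => r^-1 * sin (r * y)) (cos (r * x)).
  have D := is_derive1_comp (is_derive_sin (r * x)) (dr x).
  have := @is_deriveZ _ _ _ _ r^-1 x 1 _ D.
  rewrite /GRing.scale/= (_ : r^-1 * _ = cos (r * x)) //; field; exact: r0.
have dcos x : is_derive x 1 (fun y : R => - r^-1 * cos (r * y)) (sin (r * x)).
  have D := is_derive1_comp (is_derive_cos (r * x)) (dr x).
  have := @is_deriveZ _ _ _ _ (- r^-1) x 1 _ D.
  rewrite /GRing.scale/= (_ : - r^-1 * _ = sin (r * x)) //; field; exact: r0.
rewrite /cintegral /=; congr (_ +i* _).
- rewrite (Rintegral_circle_derive _ dsin).
    by rewrite mulrN sinN sr oppr0 mulr0 subrr.
  by move=> x; apply: continuous_comp; [exact: crM|exact: continuous_cos].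
- rewrite (Rintegral_circle_derive _ dcos).
    by rewrite mulrN cosN subrr.
  by move=> x; apply: continuous_comp; [exact: crM|exact: continuous_sin].
Qed.

(** One-sided, with frequencies [0] to [n - 1]: only the modulus enters [fejer], and in this form
    the sum is geometric. *)
Definition dirichlet_sum n t : R[i] := \sum_(j < n) expi (j%:R * t).

(** The kernel [(sin (n t / 2) / sin (t / 2))^2 / (2 pi n)], as a squared modulus so that it is
    visibly nonnegative and needs no separate value at [t = 0]. Since the inverse of [0] is [0], it
    vanishes for [n = 0]; unit mass therefore asks for [0 < n]. *)
Definition fejer n t : R := (2 * pi * n%:R)^-1 * normc (dirichlet_sum n t) ^+ 2.

Lemma fejer_ge0 n t : 0 <= fejer n t.
Proof.
by rewrite mulr_ge0 ?sqr_ge0// invr_ge0 !mulr_ge0 ?pi_ge0.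
Qed.

Lemma conjc_dirichlet_sum n t : conjc (dirichlet_sum n t) = dirichlet_sum n (- t).
Proof.
rewrite /dirichlet_sum (big_morph (@conjc R) (id1 := 0) (op1 := +%R)).
- by apply: eq_bigr => j _; rewrite conjc_expi mulrN.
- by move=> z w; rewrite rmorphD.
- by rewrite rmorph0.
Qed.

Lemma fejerN n t : fejer n (- t) = fejer n t.
Proof. by rewrite /fejer -conjc_dirichlet_sum normc_conj. Qed.

Lemma fejerE n t : (fejer n t)%:C = ((2 * pi * n%:R)^-1)%:C *
  \sum_(j < n) \sum_(k < n) expi ((j%:R - k%:R) * t).
Proof.
rewrite rmorphM /= normc_sqr conjc_dirichlet_sum mulr_suml; congr (_ * _).
apply: eq_bigr => j _; rewrite mulr_sumr; apply: eq_bigr => k _.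
by rewrite -expiD mulrN mulrBl.
Qed.

Lemma dirichlet_sumM n t : (1 - expi t) * dirichlet_sum n t = 1 - expi (n%:R * t).
Proof.
rewrite mulr_sumr; elim: n => [|n ih].
  by rewrite big_ord0 mul0r expi0 subrr.
rewrite big_ord_recr /= ih.
have -> : n.+1%:R * t = n%:R * t + t by rewrite -natr1 mulrDl mul1r.
by rewrite expiD; ring.
Qed.

(** From the geometric sum: [|1 - e^(it)|^2 = 2 (1 - cos t)] and [|1 - e^(int)| <= 2] give
    [|dirichlet_sum n t|^2 <= 2 / (1 - cos t)]. This is the decay of order [1 / n] away from
    multiples of [2 pi]. *)
Lemma fejer_le n t : (0 < n)%N -> cos t < 1 ->
  fejer n t <= (pi * n%:R * (1 - cos t))^-1.
Proof.
move=> n0 ct; have p0 := pi_gt0 R.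
have n0' : 0 < n%:R :> R by rewrite ltr0n.
have H1 : normc (1 - expi t) ^+ 2 = 2 * (1 - cos t).
  have := cos2Dsin2 t; set c := cos t; set s := sin t => E.
  have -> : 1 - expi t = (1 - c) +i* (- s) by rewrite /expi; simpc.
  rewrite /= sqr_sqrtr ?addr_ge0 ?sqr_ge0// sqrrN.
  have -> : s ^+ 2 = 1 - c ^+ 2 by rewrite -E; ring.
  by ring.
have H2 : normc (1 - expi (n%:R * t)) <= 2.
  apply: le_trans (normcD _ _) _.
  by rewrite normcN normc_expi normc1.
have H3 : 2 * (1 - cos t) * normc (dirichlet_sum n t) ^+ 2 <= 4.
  rewrite -H1 -exprMn -normcM dirichlet_sumM.
  have -> : 4 = 2 ^+ 2 :> R by ring.
  by rewrite lerXn2r ?nnegrE ?normc_ge0.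
set q := normc _ ^+ 2 in H3 *.
have c0 : 0 < 1 - cos t by rewrite subr_gt0.
rewrite /fejer -/q ler_pdivrMl ?mulr_gt0// -[leRHS]mulrC ler_pdivlMl ?mulr_gt0//.
have -> : pi * n%:R * (1 - cos t) * q = (pi * n%:R) * ((1 - cos t) * q) by ring.
have -> : 2 * pi * n%:R = (pi * n%:R) * 2 :> R by ring.
by rewrite ler_pM2l ?mulr_gt0//; lra.
Qed.

Lemma continuous_bigsum (I : Type) (s : seq I) (f : I -> R -> R) :
  (forall i, continuous (f i)) -> continuous (fun x => \sum_(i <- s) f i x).
Proof.
move=> cf; elim: s => [|i s ih].
  by under eq_fun do rewrite big_nil; move=> x; exact: cvg_cst.
under eq_fun do rewrite big_cons.
by move=> x; apply: cvgD; [exact: cf|exact: ih].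
Qed.

Lemma continuous_fejer n : continuous (fejer n).
Proof.
have -> : fejer n = fun t => (2 * pi * n%:R)^-1 *
    \sum_(j < n) \sum_(k < n) cos ((j%:R - k%:R) * t).
  apply/funext => t; have := congr1 (@complex.Re R) (fejerE n t).
  rewrite ReM /= mul0r subr0 => ->; congr (_ * _).
  rewrite (big_morph (@complex.Re R) (id1 := 0) (op1 := +%R))//; last first.
    by move=> z w; rewrite ReD.
  apply: eq_bigr => j _.
  rewrite (big_morph (@complex.Re R) (id1 := 0) (op1 := +%R))//.
  by move=> z w; rewrite ReD.
move=> t; apply: cvgM; first exact: cvg_cst.
apply: continuous_bigsum => j; apply: continuous_bigsum => k {}t.
apply: continuous_comp; last exact: continuous_cos.
by apply: cvgM; [exact: cvg_cst|exact: cvg_id].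
Qed.

Definition fejer_mean n (h : R -> R[i]) x : R[i] :=
  cintegral (fun y => (fejer n (x - y))%:C * h y).

(** Exhibits the mean as a trigonometric polynomial in [x]. Frequency [j - k] comes multiplied by
    the integral of [h] against the opposite character, so frequencies absent from [h] are absent
    from its means. *)
Lemma fejer_meanE n h x : cintegrable h ->
  fejer_mean n h x = ((2 * pi * n%:R)^-1)%:C *
   \sum_(j < n) \sum_(k < n) (expi ((j%:R - k%:R) * x) *
     cintegral (fun y => expi ((k%:R - j%:R) * y) * h y)).
Proof.
move=> ih; rewrite /fejer_mean.
have -> : (fun y => (fejer n (x - y))%:C * h y) =
    (fun y => ((2 * pi * n%:R)^-1)%:C * \sum_(j < n) \sum_(k < n)
      (expi ((j%:R - k%:R) * x) * (expi ((k%:R - j%:R) * y) * h y))).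
  apply/funext => y; rewrite fejerE -mulrA; congr (_ * _).
  rewrite mulr_suml; apply: eq_bigr => j _.
  rewrite mulr_suml; apply: eq_bigr => k _.
  by rewrite mulrA -expiD; congr (expi _ * _); ring.
rewrite cintegralZ; last first.
  do 2 (apply: cintegrable_sum => ?).
  by apply: cintegrableZ; exact: cintegrable_expiM.
congr (_ * _); rewrite cintegral_sum; last first.
  move=> j; apply: cintegrable_sum => k.
  by apply: cintegrableZ; exact: cintegrable_expiM.
apply: eq_bigr => j _; rewrite cintegral_sum; last first.
  by move=> k; apply: cintegrableZ; exact: cintegrable_expiM.
by apply: eq_bigr => k _; rewrite cintegralZ//; exact: cintegrable_expiM.
Qed.

(** Expand the mean of the constant [1]: only the [n] diagonal terms survive, each equal to [2 pi],
    and their sum cancels the normalising factor. *)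
Lemma Rintegral_fejer n x : (0 < n)%N ->
  \int[mu]_(y in circle R) fejer n (x - y) = 1.
Proof.
move=> n0; have p0 := pi_gt0 R.
have i1 : cintegrable (fun=> 1 : R[i]).
  rewrite (_ : (fun=> 1) = fun y : R => expi (0 * y)); first exact: cintegrable_expi.
  by apply/funext => y; rewrite mul0r expi0.
have := @fejer_meanE n (fun=> 1) x i1.
have -> : \sum_(j < n) \sum_(k < n) expi ((j%:R - k%:R) * x) *
    cintegral (fun y : R => expi ((k%:R - j%:R) * y) * 1) = (n%:R * (2 * pi))%:C.
  rewrite (eq_bigr (fun=> (2 * pi)%:C)).
    by rewrite sumr_const card_ord !mulr_natl !rmorphMn.
  move=> j _; rewrite (bigD1 j)//= big1 ?addr0.
    under eq_fun do rewrite mulr1.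
    by rewrite cintegral_expi eqxx mul1r subrr mul0r expi0 mul1r.
  move=> k kj; under eq_fun do rewrite mulr1.
  by rewrite cintegral_expi (inj_eq val_inj) (negbTE kj) mul0r mulr0.
rewrite -rmorphM /= => /(congr1 (@complex.Re R)).
rewrite /fejer_mean /cintegral /= => E.
transitivity (\int[lebesgue_measure]_(y in circle R)
    complex.Re ((fejer n (x - y))%:C * 1)).
  by apply: eq_Rintegral => y _; rewrite mulr1.
by rewrite E [n%:R * _]mulrC mulVf// gt_eqF// !mulr_gt0// ltr0n.
Qed.

End FejerKernel.

(** * Fejer means of real functions *)

Section CircleIntegral.
Variable R : realType.
Implicit Types f g : R -> R.
Let mu := @lebesgue_measure R.

Lemma integrable_mfun f :
  mu.-integrable (circle R) (EFin \o f) -> measurable_fun (circle R) f.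
Proof. by move=> /measurable_int/measurable_EFinP. Qed.

Lemma ge0_integrable f : measurable_fun (circle R) f ->
  (forall x, circle R x -> 0 <= f x) ->
  (\int[mu]_(x in circle R) (f x)%:E < +oo)%E ->
  mu.-integrable (circle R) (EFin \o f).
Proof.
move=> mf f0 foo; apply/integrableP; split; first exact/measurable_EFinP.
apply: le_lt_trans foo; apply: ge0_le_integral => //.
- by apply: measurableT_comp => //; exact/measurable_EFinP.
- exact/measurable_EFinP.
- by move=> x /f0 fx; rewrite lee_fin ger0_norm.
Qed.

Lemma ae_le_circle_integral f g :
  measurable_fun (circle R) f -> measurable_fun (circle R) g ->
  (forall x, circle R x -> 0 <= f x) -> (forall x, circle R x -> 0 <= g x) ->
  (\forall x \ae mu, circle R x -> f x <= g x) ->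
  (\int[mu]_(x in circle R) (f x)%:E <= \int[mu]_(x in circle R) (g x)%:E)%E.
Proof.
move=> mf mg f0 g0 fg; apply: ae_ge0_le_integral => //.
- exact/measurable_EFinP.
- exact/measurable_EFinP.
Qed.

Lemma ae_bounded_integrable (B : R) f : measurable_fun (circle R) f ->
  (\forall x \ae mu, circle R x -> `|f x| <= B) ->
  mu.-integrable (circle R) (EFin \o f).
Proof.
move=> mf fB; apply/integrableP; split; first exact/measurable_EFinP.
(* [B] carries no sign hypothesis, hence the dominating constant [|B|]. *)
apply: (@le_lt_trans _ _ (\int[mu]_(x in circle R) `|B|%:E)%E).
  apply: (@ae_le_circle_integral (fun x => `|f x|) (fun=> `|B|)) => //.
  - exact: measurableT_comp.
  - by apply: ae_imply fB => x H /H /le_trans; apply; exact: ler_norm.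
have /integrable_lty : mu.-integrable (circle R) (EFin \o (fun=> `|B|)).
  apply: (bounded_integrable (B := `|B|)) => // x _.
  by rewrite normr_id.
exact.
Qed.

Lemma measurable_fejerB n (x : R) : measurable_fun (circle R) (fun y => fejer n (x - y)).
Proof.
apply: measurable_funTS; apply: continuous_measurable_fun => y.
apply: (@continuous_comp _ _ _ (fun y => x - y) (fejer n)); last exact: continuous_fejer.
by apply: cvgB; [exact: cvg_cst|exact: cvg_id].
Qed.

Lemma fejer_bounded n : exists C : R, forall t, fejer n t <= C.
Proof.
exists ((2 * pi * n%:R)^-1 * n%:R ^+ 2) => t.
rewrite ler_wpM2l// ?invr_ge0 ?mulr_ge0 ?pi_ge0// lerXn2r ?nnegrE ?normc_ge0//.
rewrite /dirichlet_sum; elim: n => [|n ih]; first by rewrite big_ord0 normc0.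
rewrite big_ord_recr /= -natr1; apply: le_trans (normcD _ _) _.
by rewrite lerD// normc_expi.
Qed.

Lemma integrable_fejerM n (x : R) f : mu.-integrable (circle R) (EFin \o f) ->
  mu.-integrable (circle R) (EFin \o (fun y => fejer n (x - y) * f y)).
Proof.
have [C FC] := fejer_bounded n.
move=> fi; have := integrableMr (mu := mu) (@measurable_circle R)
  (measurable_fejerB n x) _ fi; apply.
exists C; split; first exact: num_real.
move=> c Cc y _ /=; rewrite ger0_norm ?fejer_ge0//.
exact: le_trans (FC _) (ltW Cc).
Qed.

Lemma integrable_fejer n (x : R) :
  mu.-integrable (circle R) (EFin \o (fun y => fejer n (x - y))).
Proof.
have [C FC] := fejer_bounded n.
apply: (bounded_integrable (B := C)) => [|y _]; first exact: measurable_fejerB.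
by rewrite ger0_norm ?fejer_ge0.
Qed.

(** The kernel is real, so real and imaginary parts are averaged separately; the order and
    absolute-value arguments are carried out on these real means. *)
Definition rfejer_mean n f (x : R) : R :=
  \int[mu]_(y in circle R) (fejer n (x - y) * f y).

Lemma le_rfejer_mean n f x : mu.-integrable (circle R) (EFin \o f) ->
  `|rfejer_mean n f x| <= rfejer_mean n (fun y => `|f y|) x.
Proof.
move=> fi; apply: le_trans (le_normr_Rintegral _ (integrable_fejerM n x fi)) _ => //.
apply: le_Rintegral => //.
- exact: integrable_norm (integrable_fejerM n x fi).
- exact: integrable_fejerM (integrable_norm fi).
- by move=> y _; rewrite normrM (ger0_norm (fejer_ge0 _ _)).
Qed.

Lemma rfejer_meanB n f g x : mu.-integrable (circle R) (EFin \o f) ->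
  mu.-integrable (circle R) (EFin \o g) ->
  rfejer_mean n (fun y => f y - g y) x = rfejer_mean n f x - rfejer_mean n g x.
Proof.
move=> fi gi; rewrite -RintegralB//; try exact: integrable_fejerM.
by apply: eq_Rintegral => y _; rewrite mulrBr.
Qed.

Lemma rfejer_mean_cst n (r x : R) : (0 < n)%N -> rfejer_mean n (fun=> r) x = r.
Proof.
move=> n0; rewrite /rfejer_mean RintegralZr//; last exact: integrable_fejer.
by rewrite Rintegral_fejer// mul1r.
Qed.

(** Averaging against a nonnegative kernel of mass one cannot exceed an essential bound. The
    conclusion holds at every [x], since null sets disappear under the integral. *)
Lemma rfejer_mean_le (B : R) n f x : (0 < n)%N -> measurable_fun (circle R) f ->
  (\forall x \ae mu, circle R x -> `|f x| <= B) -> `|rfejer_mean n f x| <= `|B|.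
Proof.
move=> n0 mf fB; have fi := ae_bounded_integrable mf fB.
apply: le_trans (le_rfejer_mean _ _ fi) _.
rewrite -[leRHS](rfejer_mean_cst `|B| x n0).
rewrite /rfejer_mean /Rintegral fine_le//.
- by apply: integrable_fin_num => //; exact: integrable_fejerM (integrable_norm fi).
- apply: integrable_fin_num => //; apply: integrable_fejerM.
  by apply: (bounded_integrable (B := `|B|)) => // y _; rewrite normr_id.
- apply: (@ae_le_circle_integral (fun y => fejer n (x - y) * `|f y|)
    (fun y => fejer n (x - y) * `|B|)) => //.
  + apply: measurable_funM; first exact: measurable_fejerB.
    exact: measurableT_comp.
  + by apply: measurable_funM => //; exact: measurable_fejerB.
  + by move=> y _; rewrite mulr_ge0// fejer_ge0.
  + by move=> y _; rewrite mulr_ge0// fejer_ge0.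
  + apply: ae_imply fB => y H /H fyB; rewrite ler_wpM2l ?fejer_ge0//.
    by apply: le_trans fyB _; exact: ler_norm.
Qed.

(** The mean is a trigonometric polynomial in [x], hence continuous. *)
Lemma measurable_rfejer_mean n f : mu.-integrable (circle R) (EFin \o f) ->
  measurable_fun [set: R] (rfejer_mean n f).
Proof.
move=> fi; have ci : cintegrable (fun x => (f x)%:C).
  by split => //=; exact: integrable0.
have -> : rfejer_mean n f = fun x => complex.Re (fejer_mean n (fun y => (f y)%:C) x).
  apply/funext => x; apply: eq_Rintegral => y _.
  by rewrite ReM /= mul0r subr0.
pose z (j k : nat) := cintegral (fun y : R => expi ((k%:R - j%:R) * y) * (f y)%:C).
have ReS (I : Type) (s : seq I) (F : I -> R[i]) :
    complex.Re (\sum_(i <- s) F i) = \sum_(i <- s) complex.Re (F i).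
  by rewrite (big_morph (@complex.Re R) (id1 := 0) (op1 := +%R))// => u v; rewrite ReD.
have -> : (fun x => complex.Re (fejer_mean n (fun y => (f y)%:C) x)) =
    fun x => (2 * pi * n%:R)^-1 * \sum_(j < n) \sum_(k < n)
      (cos ((j%:R - k%:R) * x) * complex.Re (z j k) -
       sin ((j%:R - k%:R) * x) * complex.Im (z j k)).
  apply/funext => x; rewrite fejer_meanE// ReM /= mul0r subr0 ReS; congr (_ * _).
  by apply: eq_bigr => j _; rewrite ReS; apply: eq_bigr => k _; rewrite ReM.
apply: continuous_measurable_fun => x.
apply: cvgM; first exact: cvg_cst.
apply: continuous_bigsum => j; apply: continuous_bigsum => k {}x.
have clin : {for x, continuous (fun y : R => (j%:R - k%:R) * y)}.
  by apply: cvgM; [exact: cvg_cst|exact: cvg_id].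
apply: cvgB; (apply: cvgM; last exact: cvg_cst).
- by apply: (@continuous_comp _ _ _ _ (@cos R)) => //; exact: continuous_cos.
- by apply: (@continuous_comp _ _ _ _ (@sin R)) => //; exact: continuous_sin.
Qed.

End CircleIntegral.

(** * Pointwise and [L^1] convergence of Fejer means *)

Section FejerConvergence.
Variable R : realType.
Implicit Types f g u : R -> R.
Let mu := @lebesgue_measure R.

(** Tonelli: since the kernel is even, it has mass one in [x] as well as in [y], so integrating
    first in [x] leaves [|u y|]. *)
Lemma rfejer_mean_contract n u : (0 < n)%N ->
  mu.-integrable (circle R) (EFin \o u) ->
  (\int[mu]_(x in circle R) (`|rfejer_mean n u x|)%:E <=
   \int[mu]_(x in circle R) (`|u x|)%:E)%E.
Proof.
move=> n0 iu; have m_u := integrable_mfun iu.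
have iau := integrable_norm iu.
pose g := (fun x => `|u x|) \_ (circle R).
have g0 x : 0 <= g x by rewrite /g patchE; case: ifP.
have mg : measurable_fun [set: R] g.
  apply/(measurable_restrict _ (measurable_circle (R := R)) measurableT).
  by rewrite setTI; exact: measurableT_comp.
(* Both restrictions to the circle are moved into the integrand, the one in [y] being hidden in [g],
   so that Tonelli is applied on the whole plane. *)
pose F := fun z : R * R => (\1_(circle R) z.1 * (fejer n (z.1 - z.2) * g z.2))%:E.
have mF : measurable_fun [set: measurableTypeR R * measurableTypeR R] F.
  have m1 : measurable_fun [set: measurableTypeR R * measurableTypeR R]
      (fun z => z.1 : R).
    by have := @measurable_fst _ _ (measurableTypeR R) (measurableTypeR R).
  have m2 : measurable_fun [set: measurableTypeR R * measurableTypeR R]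
      (fun z => z.2 : R).
    by have := @measurable_snd _ _ (measurableTypeR R) (measurableTypeR R).
  have mi : measurable_fun [set: R] (\1_(circle R) : R -> R).
    exact: measurable_indic.
  have mf : measurable_fun [set: R] (@fejer R n).
    by apply: continuous_measurable_fun; exact: continuous_fejer.
  apply/measurable_EFinP; apply: measurable_funM.
    exact: (measurableT_comp mi m1).
  apply: measurable_funM.
    exact: (measurableT_comp mf (measurable_funB m1 m2)).
  exact: (measurableT_comp mg m2).
have F0 z : (0 <= F z)%E by rewrite lee_fin mulr_ge0// mulr_ge0// fejer_ge0.
have E1 x : circle R x ->
    (\int[mu]_y F (x, y) = (rfejer_mean n (fun y => `|u y|) x)%:E)%E.
  move=> cx; rewrite /rfejer_mean /Rintegral fineK; last first.
    by apply: integrable_fin_num => //; exact: integrable_fejerM.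
  rewrite [RHS]integral_mkcond; apply: eq_integral => y _.
  rewrite /F /= indicE mem_set// mul1r /g !patchE.
  by case: ifP => _; rewrite ?mulr0.
have E2 y : (\int[mu]_x F (x, y) = (g y)%:E)%E.
  transitivity (\int[mu]_(x in circle R) (fejer n (y - x) * g y)%:E)%E.
    rewrite [RHS]integral_mkcond; apply: eq_integral => x _.
    rewrite /F /= indicE patchE -(opprB y x) fejerN.
    by case: ifP => _; rewrite ?mul1r ?mul0r.
  rewrite -[LHS]fineK; last first.
    apply: integrable_fin_num => //.
    have := integrableZr (mu := mu) (measurable_circle (R := R)) (g y) (integrable_fejer n y).
    exact.
  have := RintegralZr (mu := mu) (g y) (measurable_circle (R := R)) (integrable_fejer n y).
  by rewrite Rintegral_fejer// mul1r /Rintegral => ->.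
apply: (@le_trans _ _ (\int[mu]_(x in circle R) (rfejer_mean n (fun y => `|u y|) x)%:E)%E).
  apply: ae_le_circle_integral => //.
  - apply: measurable_funTS.
    have := measurableT_comp (@normr_measurable R setT) (measurable_rfejer_mean n iu).
    exact.
  - by apply: measurable_funTS; exact: (measurable_rfejer_mean n iau).
  - by move=> x _; apply: le_trans (le_rfejer_mean _ _ iu).
  - by apply: aeW => x _; exact: le_rfejer_mean.
have -> : (\int[mu]_(x in circle R) (rfejer_mean n (fun y => `|u y|) x)%:E =
    \int[mu]_x \int[mu]_y F (x, y))%E.
  rewrite [LHS]integral_mkcond; apply: eq_integral => x _.
  rewrite patchE; case: ifPn => [/set_mem cx|cx]; first by rewrite E1.
  rewrite integral0_eq// => y _.
  by rewrite /F /= indicE (negbTE cx) mul0r.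
rewrite (_ : (\int[mu]_x \int[mu]_y F (x, y) = \int[mu]_y (g y)%:E)%E); last first.
  apply: eq_trans (@fubini_tonelli _ _ _ _ _ mu mu F mF F0) _.
  by apply: eq_integral => y _; exact: E2.
rewrite le_eqVlt; apply/orP; left; apply/eqP; rewrite [RHS]integral_mkcond.
apply: eq_integral => y _; rewrite /g !patchE.
by case: ifP.
Qed.

(** A difference of two points of the circle ranges up to [2 pi], where [cos] returns to [1]; the
    upper bound on [|t|] excludes this wrap-around. Beyond [pi], reflect [t] to [2 pi - t]. *)
Lemma cos_le_far (d t : R) : 0 < d <= pi -> d <= `|t| <= 2 * pi - d ->
  cos t <= cos d.
Proof.
move=> /andP[d0 dpi] /andP[dt td]; rewrite -cos_norm; move: dt td.
set s := `|t| => ds sd.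
have H r : d <= r <= pi -> cos r <= cos d.
  move=> /andP[dr rpi]; rewrite leNgt ltr_cos ?in_itv/= -?leNgt//.
  - by rewrite rpi (le_trans _ dr)// ltW.
  - by rewrite dpi ltW.
have [spi|pis] := leP s pi; first by apply: H; rewrite ds.
have -> : cos s = cos (2 * pi - s).
  by rewrite -cosN -[in LHS]cosD2pi; congr cos; rewrite mulr_natl addrC.
by apply: H; lra.
Qed.

Lemma cvg_rfejer_mean (f : R -> R) x : {for x, continuous f} ->
  mu.-integrable (circle R) (EFin \o f) -> - pi < x < pi ->
  rfejer_mean n f x @[n --> \oo] --> f x.
Proof.
move=> cf fi /andP[x1 x2]; have p0 := pi_gt0 R.
apply/cvgrPdist_le => e e0.
have e2 : 0 < e / 2 by lra.
move/cvgrPdist_le : cf => /(_ _ e2) [r /= r0 rf].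
(* The first term keeps [|x - y| < d] inside the continuity radius; the second gives
   [|x - y| <= |x| + pi <= 2 pi - d] for all [y] in the circle. It is positive because [x] is
   interior. *)
pose d := Num.min (r / 2) (pi - `|x|).
have xpi : `|x| < pi by rewrite ltr_norml x1.
have d0 : 0 < d by rewrite lt_min divr_gt0//= subr_gt0.
have dr : d < r.
  by rewrite gt_min; apply/orP; left; lra.
have dpi : d <= pi - `|x| by rewrite ge_min lexx orbT.
have dpi' : d <= pi by have := normr_ge0 x; lra.
have cd : cos d < 1.
  by rewrite -[ltRHS]cos0 ltr_cos ?in_itv/= ?lexx ?(ltW d0) ?(ltW p0) ?dpi'.
pose K := \int[mu]_(y in circle R) `|f x - f y|.
have ig : mu.-integrable (circle R) (EFin \o (fun y => f x - f y)).
  have ic : mu.-integrable (circle R) (EFin \o (fun=> f x)).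
    exact: (bounded_integrable (B := `|f x|)).
  exact: (integrableB _ ic fi).
have iag := integrable_norm ig.
have K0 : 0 <= K by apply: Rintegral_ge0.
have key n : (0 < n)%N ->
    `|f x - rfejer_mean n f x| <= e / 2 + (pi * n%:R * (1 - cos d))^-1 * K.
  move=> n0; have -> : f x - rfejer_mean n f x = rfejer_mean n (fun y => f x - f y) x.
    rewrite (@rfejer_meanB _ n (fun=> f x))// ?rfejer_mean_cst//.
    exact: (bounded_integrable (B := `|f x|)).
  apply: le_trans (le_rfejer_mean _ _ ig) _.
  set c := (pi * _ * _)^-1; have c0 : 0 <= c.
    by rewrite invr_ge0 mulr_ge0 ?subr_ge0 ?(ltW cd)// mulr_ge0// ltW.
  have i1 : mu.-integrable (circle R) (EFin \o (fun y => fejer n (x - y) * (e / 2))).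
    by apply: integrable_fejerM; exact: (bounded_integrable (B := `|e / 2|)).
  have i2 : mu.-integrable (circle R) (EFin \o (fun y => c * `|f x - f y|)).
    exact: (integrableZl _ c iag).
  rewrite -[X in X + _ * K](@rfejer_mean_cst _ n _ x n0) -RintegralZl// -RintegralD//.
  apply: le_Rintegral => //.
  - exact: integrable_fejerM.
  - exact: (integrableD _ i1 i2).
  move=> y; rewrite /circle /= in_itv /= => /andP[y1 y2].
  (* Near [x] the increment of [f] is at most [e / 2] and the kernel has mass one; far from [x] the
     kernel is at most [c] and the increment has finite integral [K]. *)
  have [xy|xy] := ltP `|x - y| d.
    apply: (@le_trans _ _ (fejer n (x - y) * (e / 2))).
      by rewrite ler_wpM2l ?fejer_ge0// rf//= (lt_trans xy).
    by rewrite lerDl mulr_ge0.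
  apply: (@le_trans _ _ (c * `|f x - f y|)); last first.
    by rewrite lerDr mulr_ge0 ?fejer_ge0 ?ltW.
  rewrite ler_wpM2r//.
  have cxy : cos (x - y) <= cos d.
    apply: cos_le_far; rewrite ?d0 ?xy//=.
    have := ler_normB x y; have : `|y| <= pi by rewrite ler_norml y1.
    by lra.
  apply: le_trans (fejer_le n0 (le_lt_trans cxy cd)) _.
  have pn : 0 < pi * n%:R :> R by rewrite mulr_gt0// ltr0n.
  have c1 : 0 < 1 - cos d by rewrite subr_gt0.
  have c2 : 0 < 1 - cos (x - y) by rewrite subr_gt0 (le_lt_trans cxy).
  by rewrite /c lef_pV2 ?posrE ?[0 < _ * (1 - _)]mulr_gt0// ler_pM2l//; lra.
(* The order from which the far contribution [K / (pi * (1 - cos d)) / n] is at most [e / 2]. *)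
pose L := K / (pi * (1 - cos d)) / (e / 2).
exists (Num.truncn L).+1 => // n /= Ln.
have n0 : (0 < n)%N by exact: leq_ltn_trans Ln.
have n0' : 0 < n%:R :> R by rewrite ltr0n.
apply: le_trans (key n n0) _.
have LN : L <= n%:R.
  apply: (le_trans (ltW (truncnS_gt _))); by rewrite ler_nat.
have c1 : 0 < 1 - cos d by rewrite subr_gt0.
rewrite [leRHS](splitr e) lerD2l.
have -> : (pi * n%:R * (1 - cos d))^-1 * K = K / (pi * (1 - cos d)) / n%:R.
  by rewrite !invfM; ring.
by rewrite ler_pdivrMr// -(ler_pdivrMl _ _ e2) mulrC.
Qed.

Lemma cvg_rfejer_mean_L1_continuous f : continuous f ->
  mu.-integrable (circle R) (EFin \o f) ->
  (\int[mu]_(x in circle R) (`|rfejer_mean n f x - f x|)%:E)%E @[n --> \oo] --> 0%E.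
Proof.
move=> cf fi.
have [B fB] : exists B, forall x, circle R x -> `|f x| <= B.
  have : compact (f @` circle R).
    apply: continuous_compact; first exact: continuous_subspaceT.
    exact: segment_compact.
  move=> /compact_bounded [M [_ /(_ (M + 1))]] H; exists (M + 1) => x cx.
  by apply: H; [rewrite ltrDl|exists x].
have mf := integrable_mfun fi.
(* Shifted by one because the sup bound is stated for positive orders; [cvg_shiftS] undoes the
   shift. *)
pose T n x := (rfejer_mean n.+1 f x)%:E.
have mT n : measurable_fun (circle R) (T n).
  apply/measurable_EFinP; apply: measurable_funTS.
  exact: (measurable_rfejer_mean n.+1 fi).
have mfE : measurable_fun (circle R) (EFin \o f) by exact/measurable_EFinP.
(* The endpoints are left out: [f] is not assumed periodic, and at [-pi] or [pi] the kernel also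
   gathers values near the opposite end. *)
have Tf : {ae mu, forall x, circle R x -> T ^~ x @ \oo --> (EFin \o f) x}.
  exists [set - pi; pi]; split.
  - by apply: measurableU; exact: measurable_set1.
  - apply: countable_lebesgue_measure0; apply: finite_set_countable.
    exact: finite_set2.
  move=> x /= /not_implyP[cx nT]; apply: contrapT => /not_orP[x1 x2]; apply: nT.
  apply: cvg_EFin; first exact: nearW.
  have xpi : - pi < x < pi.
    move: cx; rewrite /circle /= in_itv /= => /andP[a b].
    by rewrite !lt_neqAle a b !andbT eq_sym; apply/andP; split; apply/eqP.
  have := cvg_rfejer_mean (cf x) fi xpi.
  by move/(cvg_comp (@succn) _ (cvg_addnl 1)) .
have ig : mu.-integrable (circle R) (EFin \o (fun=> `|B|)).
  by apply: (bounded_integrable (B := `|B|)) => // x _; rewrite normr_id.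
have Tg : {ae mu, forall x n, circle R x -> (`|T n x| <= (EFin \o (fun=> `|B|%R)) x)%E}.
  apply: aeW => x n cx; rewrite lee_fin; apply: rfejer_mean_le => //.
  by apply: aeW => y cy; exact: fB.
have [_ H _] := @dominated_convergence _ _ _ (lebesgue_measure : {measure set (measurableTypeR R) -> \bar R}) _
  (@measurable_circle R) T _ _ mT mfE Tf ig Tg.
by rewrite -(cvg_shiftS).
Qed.

Lemma near_lt_cvge0 (v : (\bar R)^nat) (e : R) : 0 < e ->
  v n @[n --> \oo] --> 0%E -> \forall n \near \oo, (v n < e%:E)%E.
Proof.
move=> e0 v0; apply: (v0 [set y | (y < e%:E)%E]).
apply: open_nbhs_nbhs; split; last by rewrite /= lte_fin.
exact: open_ereal_lt_ereal.
Qed.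

(** Continuous functions are dense in [L^1]. With [g] close to [u], the error splits into the mean
    of [u - g], the error for [g], and [g - u]; contraction bounds the first part by the third. *)
Lemma cvg_rfejer_mean_L1 u : mu.-integrable (circle R) (EFin \o u) ->
  forall e : R, 0 < e -> \forall n \near \oo,
  (\int[mu]_(x in circle R) (`|rfejer_mean n u x - u x|)%:E < e%:E)%E.
Proof.
move=> ui e e0; have e3 : 0 < e / 3 by lra.
have mcirc : measurable (circle R : set (measurableTypeR R)) by [].
have [g_ [cg ig gu]] := approximation_continuous_integrable mcirc
  (lebesgue_measure_circle_lty R) ui.
have [k uk] : exists k, (\int[mu]_(x in circle R) (`|u x - g_ k x|)%:E < (e / 3)%:E)%E.
  have := near_lt_cvge0 e3 gu.
  by move=> -[N _ /(_ N (leqnn N))] H; exists N.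
have gk := near_lt_cvge0 e3 (cvg_rfejer_mean_L1_continuous (cg k) (ig k)).
near=> n.
have gkn : (\int[mu]_(x in circle R) (`|rfejer_mean n (g_ k) x - g_ k x|)%:E < (e / 3)%:E)%E.
  by near: n.
have n0 : (0 < n)%N by near: n; exact: nbhs_infty_gt.
have iug : mu.-integrable (circle R) (EFin \o (fun x => u x - g_ k x)).
  exact: (integrableB _ ui (ig k)).
have mug := integrable_mfun iug.
have mTug : measurable_fun (circle R) (rfejer_mean n (fun x => u x - g_ k x)).
  by apply: measurable_funTS; exact: (measurable_rfejer_mean n iug).
have mTg : measurable_fun (circle R) (rfejer_mean n (g_ k)).
  by apply: measurable_funTS; exact: (measurable_rfejer_mean n (ig k)).
have mTu : measurable_fun (circle R) (rfejer_mean n u).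
  by apply: measurable_funTS; exact: (measurable_rfejer_mean n ui).
have mgk := integrable_mfun (ig k).
have m_u := integrable_mfun ui.
have mE (f : R -> R) : measurable_fun (circle R) f ->
    measurable_fun (circle R) (fun x => `|f x|).
  by move=> mf; exact: measurableT_comp.
pose a1 x := `|rfejer_mean n (fun x => u x - g_ k x) x|.
pose a2 x := `|rfejer_mean n (g_ k) x - g_ k x|.
pose a3 x := `|u x - g_ k x|.
have ma2 : measurable_fun (circle R) a2 by apply: mE; exact: measurable_funB.
have ma1 : measurable_fun (circle R) a1 by exact: mE.
have ma3 : measurable_fun (circle R) a3 by exact: mE.
apply: (@le_lt_trans _ _ (\int[mu]_(x in circle R) (a1 x + a2 x + a3 x)%:E)%E).
  apply: ae_le_circle_integral => //.
  - by apply: mE; exact: measurable_funB.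
  - by apply: measurable_funD => //; exact: measurable_funD.
  - by move=> x _; rewrite !addr_ge0 ?normr_ge0.
  apply: aeW => x _.
  rewrite /a1 /a2 /a3 rfejer_meanB// [in X in _ <= _ + X]distrC.
  set p := rfejer_mean n u x; set q := rfejer_mean n (g_ k) x.
  rewrite (_ : p - u x = (p - q) + (q - g_ k x) + (g_ k x - u x)); last by ring.
  by apply: le_trans (ler_normD _ _) _; rewrite lerD2r ler_normD.
under eq_integral do rewrite !EFinD.
rewrite ge0_integralD//=; last 4 first.
- by move=> x _; rewrite -EFinD lee_fin addr_ge0 ?normr_ge0.
- by under eq_fun do rewrite -EFinD; apply/measurable_EFinP; exact: measurable_funD.
- by move=> x _; rewrite lee_fin normr_ge0.
- exact/measurable_EFinP.
rewrite ge0_integralD//=; last 4 first.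
- by move=> x _; rewrite lee_fin normr_ge0.
- exact/measurable_EFinP.
- by move=> x _; rewrite lee_fin normr_ge0.
- exact/measurable_EFinP.
have -> : e%:E = ((e / 3)%:E + (e / 3)%:E + (e / 3)%:E)%E.
  by rewrite -!EFinD; congr EFin; field.
rewrite !lteD//.
exact: le_lt_trans (rfejer_mean_contract n0 iug) uk.
Unshelve. all: end_near. Qed.

End FejerConvergence.

(** * Weighted convergence of Fejer means *)

Section NonnegIntegral.
Variable R : realType.
Implicit Types (f g : R -> R) (h k : R -> R[i]).
Let mu := @lebesgue_measure R.

Lemma circle_integralD f g :
  measurable_fun (circle R) f -> measurable_fun (circle R) g ->
  (forall x, circle R x -> 0 <= f x) -> (forall x, circle R x -> 0 <= g x) ->
  (\int[mu]_(x in circle R) (f x + g x)%:E =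
   \int[mu]_(x in circle R) (f x)%:E + \int[mu]_(x in circle R) (g x)%:E)%E.
Proof.
move=> mf mg f0 g0; under eq_integral do rewrite EFinD.
by rewrite ge0_integralD//; exact/measurable_EFinP.
Qed.

Lemma circle_integralZ (c : R) f : measurable_fun (circle R) f ->
  (forall x, circle R x -> 0 <= f x) -> 0 <= c ->
  (\int[mu]_(x in circle R) (c * f x)%:E =
   c%:E * \int[mu]_(x in circle R) (f x)%:E)%E.
Proof.
move=> mf f0 c0; under eq_integral do rewrite EFinM.
by rewrite ge0_integralZl_EFin//; exact/measurable_EFinP.
Qed.

Lemma measurable_normc h : cmeasurable h ->
  measurable_fun (circle R) (fun x => normc (h x)).
Proof.
move=> [mr mi].
have -> : (fun x => normc (h x)) =
    fun x => (complex.Re (h x) ^+ 2 + complex.Im (h x) ^+ 2) `^ 2^-1.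
  apply/funext => x; case: (h x) => a b /=.
  by rewrite powR12_sqrt// addr_ge0 ?sqr_ge0.
apply: (measurableT_comp (@measurable_powR R 2^-1)).
by apply: measurable_funD; exact: measurable_funX.
Qed.

Lemma measurable_normc_powR (b : R) h : cmeasurable h ->
  measurable_fun (circle R) (fun x => normc (h x) `^ b).
Proof.
by move=> mh; apply: (measurableT_comp (@measurable_powR R b)); exact: measurable_normc.
Qed.

Lemma cmeasurableD h k : cmeasurable h -> cmeasurable k ->
  cmeasurable (fun x => h x + k x).
Proof.
move=> [h1 h2] [k1 k2]; split.
- by under eq_fun do rewrite ReD; exact: measurable_funD.
- by under eq_fun do rewrite ImD; exact: measurable_funD.
Qed.

Lemma cmeasurableM h k : cmeasurable h -> cmeasurable k ->
  cmeasurable (fun x => h x * k x).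
Proof.
move=> [h1 h2] [k1 k2]; split.
- by under eq_fun do rewrite ReM; apply: measurable_funB; exact: measurable_funM.
- by under eq_fun do rewrite ImM; apply: measurable_funD; exact: measurable_funM.
Qed.

Lemma cmeasurableB h k : cmeasurable h -> cmeasurable k ->
  cmeasurable (fun x => h x - k x).
Proof.
move=> mh [k1 k2]; apply: cmeasurableD => //; split.
- by under eq_fun do rewrite ReN; exact: measurableT_comp.
- by under eq_fun do rewrite ImN; exact: measurableT_comp.
Qed.

Lemma cintegrable_cmeasurable h : cintegrable h -> cmeasurable h.
Proof. by move=> [h1 h2]; split; exact: integrable_mfun. Qed.

Lemma cmeasurable_neg_trig n c : cmeasurable (@neg_trig R n c).
Proof.
apply: cintegrable_cmeasurable; rewrite /neg_trig.
apply: cintegrable_sum => k; apply: cintegrableZ.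
by under eq_fun do rewrite -mulNr; exact: cintegrable_expi.
Qed.

Lemma ae_bounded_cintegrable (B : R) h : cmeasurable h ->
  (\forall x \ae mu, circle R x -> normc (h x) <= B) -> cintegrable h.
Proof.
move=> [mr mi] hB; split.
- apply: (ae_bounded_integrable (B := B)) => //; apply: ae_imply hB => x H /H.
  exact: le_trans (normc_Re _).
- apply: (ae_bounded_integrable (B := B)) => //; apply: ae_imply hB => x H /H.
  exact: le_trans (normc_Im _).
Qed.

End NonnegIntegral.

Section FejerWeighted.
Variable R : realType.
Implicit Types (w : R -> R) (h : R -> R[i]).
Let mu := @lebesgue_measure R.

Lemma fejer_mean_rfejer n h x : fejer_mean n h x =
  rfejer_mean n (fun y => complex.Re (h y)) x +i*
  rfejer_mean n (fun y => complex.Im (h y)) x.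
Proof.
rewrite /fejer_mean /cintegral; congr (_ +i* _); apply: eq_Rintegral => y _.
- by rewrite ReM /= mul0r subr0.
- by rewrite ImM /= mul0r addr0.
Qed.

Lemma cmeasurable_fejer_mean n h : cintegrable h -> cmeasurable (fejer_mean n h).
Proof.
move=> [h1 h2]; split.
- under eq_fun do rewrite fejer_mean_rfejer /=.
  by apply: measurable_funTS; exact: (measurable_rfejer_mean n h1).
- under eq_fun do rewrite fejer_mean_rfejer /=.
  by apply: measurable_funTS; exact: (measurable_rfejer_mean n h2).
Qed.

(** At each point the truncation is eventually exact, and the excess is dominated by [w] itself. *)
Lemma truncated_weight w (e : R) : spectral_density w -> 0 < e ->
  exists k : nat,
  (\int[mu]_(x in circle R) (w x - Num.min (w x) k%:R)%:E < e%:E)%E.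
Proof.
move=> [w0 wi] e0; have mw := integrable_mfun wi.
pose T (k : nat) x := (w x - Num.min (w x) k%:R)%:E.
have mT k : measurable_fun (circle R) (T k).
  apply/measurable_EFinP; apply: measurable_funB => //.
  exact: measurable_minr.
have m0 : measurable_fun (circle R) (fun=> 0 : \bar R)%E by exact: measurable_cst.
have Tf : {ae mu, forall x, circle R x -> T ^~ x @ \oo --> (0 : \bar R)}.
  apply: aeW => x cx; apply: cvg_near_cst.
  exists (Num.truncn (w x)).+1 => // k /= wk.
  rewrite /T min_l ?subrr//.
  by apply: (le_trans (ltW (truncnS_gt _))); rewrite ler_nat.
have Tg : {ae mu, forall x k, circle R x -> (`|T k x| <= (EFin \o w) x)%E}.
  apply: aeW => x k cx; rewrite lee_fin ger0_norm.
    by rewrite gerBl le_min w0 ?ler0n.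
  by rewrite subr_ge0 ge_min lexx.
have [_ _ H] := @dominated_convergence _ _ _
  (lebesgue_measure : {measure set (measurableTypeR R) -> \bar R}) _
  (@measurable_circle R) T _ _ mT m0 Tf wi Tg.
rewrite integral0 in H.
have [k _ /(_ k (leqnn k))] := near_lt_cvge0 e0 H.
by exists k.
Qed.

(** Write [w = W + m] with [m = min(w, k)] and let [d] be the pointwise distance from [h] to its
    mean. Against [W], use [d^alpha <= D^alpha]; against [m <= k], use [d^alpha <= D^(alpha-1) * d]
    and [L^1] convergence. The level [k] is fixed before the order [n]. *)
Lemma fejer_mean_weighted (alpha B : R) h w (e : R) : 1 <= alpha ->
  spectral_density w -> cmeasurable h ->
  (\forall x \ae mu, circle R x -> normc (h x) <= B) -> 0 < e ->
  exists n, (\int[mu]_(x in circle R)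
    (normc (h x - fejer_mean n h x) `^ alpha * w x)%:E < e%:E)%E.
Proof.
move=> a1 dw mh hB e0; have [w0 wi] := dw; have mw := integrable_mfun wi.
have ih := ae_bounded_cintegrable mh hB; have [ir ii] := ih; have [mr mi] := mh.
(* Each of the real and imaginary parts, and each of their means, is bounded by [|B|]; the extra [1]
   makes [D] positive so that [D^alpha] can be divided by. *)
pose D := 4 * `|B| + 1.
have D0 : 0 < D by rewrite ltr_wpDl// mulr_ge0.
have Da0 : 0 < D `^ alpha by exact: powR_gt0.
have [k wk] := truncated_weight dw (divr_gt0 e0 (mulr_gt0 (ltr0n R 2 : 0 < 2) Da0)).
pose C := D `^ (alpha - 1) * k%:R.
have C0 : 0 <= C by rewrite mulr_ge0// powR_ge0.
(* The two [L^1] errors, each below [e / (4 * (C + 1))], together contribute at most [e / 2] after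
   multiplication by [C]; the [+ 1] covers [C = 0]. *)
have C1 : 0 < 4 * (C + 1) by rewrite mulr_gt0// ltr_wpDl.
have ce : 0 < e / (4 * (C + 1)) by exact: divr_gt0.
have nr := cvg_rfejer_mean_L1 ir ce.
have ni := cvg_rfejer_mean_L1 ii ce.
have [n [n0 [Hr Hi]]] : exists n, (0 < n)%N /\
  ((\int[mu]_(x in circle R) (`|rfejer_mean n (fun y => complex.Re (h y)) x
       - complex.Re (h x)|)%:E < (e / (4 * (C + 1)))%:E)%E /\
  (\int[mu]_(x in circle R) (`|rfejer_mean n (fun y => complex.Im (h y)) x
       - complex.Im (h x)|)%:E < (e / (4 * (C + 1)))%:E)%E).
  near \oo => n; exists n; split; [|split].
  - by near: n; exact: nbhs_infty_gt.
  - by near: n.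
  - by near: n.
exists n.
pose u x := complex.Re (h x); pose v x := complex.Im (h x).
pose r1 x := `|rfejer_mean n u x - u x|.
pose r2 x := `|rfejer_mean n v x - v x|.
pose W x := w x - Num.min (w x) k%:R.
have mr1 : measurable_fun (circle R) r1.
  apply: (measurableT_comp (@normr_measurable R setT)); apply: measurable_funB => //.
  by apply: measurable_funTS; exact: (measurable_rfejer_mean n ir).
have mr2 : measurable_fun (circle R) r2.
  apply: (measurableT_comp (@normr_measurable R setT)); apply: measurable_funB => //.
  by apply: measurable_funTS; exact: (measurable_rfejer_mean n ii).
have mW : measurable_fun (circle R) W.
  by apply: measurable_funB => //; exact: measurable_minr.
have W0 x : 0 <= W x by rewrite subr_ge0 ge_min lexx.
have r10 x : 0 <= r1 x by rewrite normr_ge0.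
have r20 x : 0 <= r2 x by rewrite normr_ge0.
have uB : \forall x \ae mu, circle R x -> `|u x| <= B.
  by apply: ae_imply hB => x H /H; exact: le_trans (normc_Re _).
have vB : \forall x \ae mu, circle R x -> `|v x| <= B.
  by apply: ae_imply hB => x H /H; exact: le_trans (normc_Im _).
apply: (@le_lt_trans _ _ (\int[mu]_(x in circle R)
    (D `^ alpha * W x + C * (r1 x + r2 x))%:E)%E).
  apply: ae_le_circle_integral => //.
  - apply: measurable_funM => //; apply: measurable_normc_powR.
    by apply: cmeasurableB => //; exact: cmeasurable_fejer_mean.
  - apply: measurable_funD; apply: measurable_funM => //.
    exact: measurable_funD.
  - by move=> x cx; rewrite mulr_ge0 ?powR_ge0 ?w0.
  - by move=> x cx; rewrite addr_ge0// mulr_ge0// ?powR_ge0// addr_ge0.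
  apply: (ae_imply2 _ uB vB) => x ux vx cx.
  set d := normc _; have d0 : 0 <= d by exact: normc_ge0.
  have dr : d <= r1 x + r2 x.
    rewrite /d normc_distrC; apply: le_trans (normc_le _) _.
    by rewrite ReD ImD ReN ImN fejer_mean_rfejer.
  have rD : r1 x + r2 x <= D.
    have := rfejer_mean_le x n0 mr uB; have := rfejer_mean_le x n0 mi vB.
    have := ler_normB (rfejer_mean n u x) (u x).
    have := ler_normB (rfejer_mean n v x) (v x).
    have := ux cx; have := vx cx; have := ler_norm B.
    by rewrite /r1 /r2 /D -/u -/v; lra.
  have dD := le_trans dr rD.
  have H1 : d `^ alpha <= D `^ alpha.
    by apply: ge0_ler_powR dD; rewrite ?nnegrE ?(ltW D0)// (le_trans ler01).
  have H2 : d `^ alpha <= D `^ (alpha - 1) * (r1 x + r2 x).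
    rewrite -mulr_powRB1//; last by lra.
    rewrite mulrC ler_pM ?powR_ge0//.
    by apply: ge0_ler_powR dD; rewrite ?nnegrE ?(ltW D0)// subr_ge0.
  pose m := Num.min (w x) k%:R.
  have m0 : 0 <= m by rewrite le_min w0 ?ler0n.
  have mk : m <= k%:R by rewrite ge_min lexx orbT.
  have -> : w x = W x + m by rewrite /W subrK.
  rewrite mulrDr lerD ?ler_wpM2r// /C mulrAC.
  by rewrite ler_pM ?powR_ge0.
rewrite circle_integralD//; last 4 first.
- exact: measurable_funM.
- by apply: measurable_funM => //; exact: measurable_funD.
- by move=> x _; rewrite mulr_ge0 ?powR_ge0.
- by move=> x _; rewrite mulr_ge0 ?addr_ge0.
rewrite circle_integralZ ?powR_ge0// circle_integralZ//; last 2 first.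
- exact: measurable_funD.
- by move=> x _; rewrite addr_ge0.
rewrite (@circle_integralD R r1 r2)//.
have I0 (f : R -> R) : (forall x, 0 <= f x) ->
    (0 <= \int[mu]_(x in circle R) (f x)%:E)%E.
  by move=> f0; apply: integral_ge0 => x _; rewrite lee_fin.
move: Hr Hi wk (I0 _ r10) (I0 _ r20) (I0 _ W0); rewrite -/u -/v -/r1 -/r2 -/W.
case: (\int[mu]_(x in circle R) (r1 x)%:E)%E => [i1| |]//.
case: (\int[mu]_(x in circle R) (r2 x)%:E)%E => [i2| |]//.
case: (\int[mu]_(x in circle R) (W x)%:E)%E => [i3| |]//.
rewrite -EFinD !lte_fin !lee_fin => H1 H2 H3 P1 P2 P3.
have E1 : D `^ alpha * i3 < e / 2.
  rewrite mulrC -ltr_pdivlMr//; apply: lt_le_trans H3 _.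
  by rewrite invfM mulrA.
have E2 : C * (i1 + i2) <= e / 2.
  apply: (@le_trans _ _ ((C + 1) * (e / (4 * (C + 1)) + e / (4 * (C + 1))))).
    by apply: ler_pM; rewrite ?addr_ge0// ?lerDl// lerD// ltW.
  have Cn : C + 1 != 0 by rewrite gt_eqF// ltr_wpDl.
  rewrite le_eqVlt; apply/orP; left; apply/eqP; field.
  exact: Cn.
by rewrite [ltRHS](splitr e) ltr_leD.
Unshelve. all: end_near. Qed.

End FejerWeighted.

(** * Negative trigonometric polynomials and membership in [Lminus] *)

Section NegativeFrequencies.
Variable R : realType.
Implicit Types (w : R -> R) (h p q : R -> R[i]).
Let mu := @lebesgue_measure R.

Definition is_neg_trig p := exists n c, forall x, p x = neg_trig n c x.

(** Padding with zero coefficients brings two polynomials to a common length before they are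
    added. *)
Lemma neg_trig_widen n N (c : nat -> R[i]) x : (n <= N)%N ->
  neg_trig n c x = neg_trig N (fun k => if (k < n)%N then c k else 0) x.
Proof.
move=> nN; rewrite /neg_trig.
rewrite (big_ord_widen N (fun k => c k * expi (- (k.+1%:R * x))) nN) big_mkcond.
by apply: eq_bigr => k _; case: ifP => //; rewrite mul0r.
Qed.

Lemma is_neg_trig0 : is_neg_trig (fun=> 0).
Proof. by exists 0, (fun=> 0) => x; rewrite /neg_trig big_ord0. Qed.

Lemma is_neg_trigD p q : is_neg_trig p -> is_neg_trig q ->
  is_neg_trig (fun x => p x + q x).
Proof.
move=> [n [c pE]] [m [d qE]].
exists (maxn n m), (fun k => (if (k < n)%N then c k else 0) +
                             (if (k < m)%N then d k else 0)) => x.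
rewrite pE qE (neg_trig_widen _ _ (leq_maxl n m)) (neg_trig_widen _ _ (leq_maxr n m)).
by rewrite /neg_trig -big_split; apply: eq_bigr => k _; rewrite /= mulrDl.
Qed.

Lemma is_neg_trigZ (a : R[i]) p : is_neg_trig p -> is_neg_trig (fun x => a * p x).
Proof.
move=> [n [c pE]]; exists n, (fun k => a * c k) => x.
by rewrite pE /neg_trig mulr_sumr; apply: eq_bigr => k _; rewrite mulrA.
Qed.

Lemma is_neg_trig_sum (I : Type) (s : seq I) (p : I -> R -> R[i]) :
  (forall i, is_neg_trig (p i)) -> is_neg_trig (fun x => \sum_(i <- s) p i x).
Proof.
move=> hp; elim: s => [|i s ih].
  by under eq_fun do rewrite big_nil; exact: is_neg_trig0.
by under eq_fun do rewrite big_cons; exact: is_neg_trigD.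
Qed.

Lemma is_neg_trig_expi (j k : nat) : (j < k)%N ->
  is_neg_trig (fun x => expi ((j%:R - k%:R) * x)).
Proof.
(* In [neg_trig] the coefficient of index [m] carries frequency [-(m + 1)], whence the
   predecessor. *)
move=> jk; pose m := (k - j).-1.
have mE : m.+1 = (k - j)%N by rewrite /m prednK// subn_gt0.
exists m.+1, (fun i => (i == m)%:R) => x.
rewrite /neg_trig big_ord_recr /= eqxx mul1r big1 ?add0r.
  by rewrite mE natrB 1?ltnW// -mulNr opprB.
by move=> i _; rewrite ltn_eqF// mul0r.
Qed.

(** In the expansion, a term of frequency [j - k >= 0] has as coefficient the integral assumed to
    vanish at index [j - k]; the case [j = k] is the constant term. Only strictly negative
    frequencies remain. *)
Lemma is_neg_trig_fejer_mean n h : cintegrable h ->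
  (forall k : nat, cintegral (fun x => expi (- (x * k%:R)) * h x) = 0) ->
  is_neg_trig (fejer_mean n h).
Proof.
move=> ih h0.
have -> : fejer_mean n h = fun x => ((2 * pi * n%:R)^-1)%:C *
   \sum_(j < n) \sum_(k < n) (expi ((j%:R - k%:R) * x) *
     cintegral (fun y => expi ((k%:R - j%:R) * y) * h y)).
  by apply/funext => x; exact: fejer_meanE.
apply: is_neg_trigZ; apply: is_neg_trig_sum => j; apply: is_neg_trig_sum => k.
have [kj|jk] := leqP k j.
  have -> : cintegral (fun y : R => expi ((k%:R - j%:R) * y) * h y) = 0.
    rewrite -[RHS](h0 (j - k)%N); congr cintegral; apply/funext => y.
    by congr (expi _ * _); rewrite natrB//; ring.
  by under eq_fun do rewrite mulr0; exact: is_neg_trig0.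
under eq_fun do rewrite mulrC.
by apply: is_neg_trigZ; exact: is_neg_trig_expi.
Qed.

Lemma weighted_norm_lt (alpha : R) w h (e : R) : 0 < alpha -> spectral_density w ->
  0 < e ->
  (\int[mu]_(x in circle R) (normc (h x) `^ alpha * w x)%:E < (e `^ alpha)%:E)%E ->
  (weighted_norm alpha w h < e%:E)%E.
Proof.
move=> a0 [w0 wi] e0; rewrite /weighted_norm.
have : (0 <= \int[mu]_(x in circle R) (normc (h x) `^ alpha * w x)%:E)%E.
  by apply: integral_ge0 => x cx; rewrite lee_fin mulr_ge0 ?powR_ge0 ?w0.
case: (\int[_]_(_ in _) _)%E => [r| |]//.
rewrite lee_fin lte_fin => r0 re; rewrite poweR_EFin lte_fin.
have -> : e = (e `^ alpha) `^ alpha^-1.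
  by rewrite -powRrM mulfV ?gt_eqF// powRr1// ltW.
by apply: gt0_ltr_powR re; rewrite ?invr_gt0 ?nnegrE ?powR_ge0.
Qed.

Lemma integral_weighted_lt (alpha : R) w h (e : R) : 0 < alpha ->
  spectral_density w -> 0 < e ->
  (weighted_norm alpha w h < e%:E)%E ->
  (\int[mu]_(x in circle R) (normc (h x) `^ alpha * w x)%:E < (e `^ alpha)%:E)%E.
Proof.
move=> a0 [w0 wi] e0; rewrite /weighted_norm.
have : (0 <= \int[mu]_(x in circle R) (normc (h x) `^ alpha * w x)%:E)%E.
  by apply: integral_ge0 => x cx; rewrite lee_fin mulr_ge0 ?powR_ge0 ?w0.
case: (\int[_]_(_ in _) _)%E => [r| |]//; last first.
  by rewrite poweRyr ?gt_eqF ?invr_gt0.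
rewrite lee_fin poweR_EFin !lte_fin => r0 re.
have -> : r = (r `^ alpha^-1) `^ alpha.
  by rewrite -powRrM mulVf ?gt_eqF// powRr1.
by apply: gt0_ltr_powR re; rewrite ?nnegrE ?powR_ge0 ?(ltW e0).
Qed.

Lemma circle_integral_lty (f : R -> R) : mu.-integrable (circle R) (EFin \o f) ->
  (\int[mu]_(x in circle R) (f x)%:E < +oo)%E.
Proof. by move=> /integrable_lty; exact. Qed.

Lemma circle_integral_fin_num (f : R -> R) :
  mu.-integrable (circle R) (EFin \o f) ->
  (\int[mu]_(x in circle R) (f x)%:E)%E \is a fin_num.
Proof. by move=> /integrable_fin_num; exact. Qed.

Lemma circle_integrableZ (c : R) (f : R -> R) :
  mu.-integrable (circle R) (EFin \o f) ->
  mu.-integrable (circle R) (EFin \o (fun x => c * f x)).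
Proof. by move=> fi; exact: (integrableZl _ c fi). Qed.

Lemma bounded_integrable_weight (alpha B : R) w h : 0 <= alpha ->
  spectral_density w -> cmeasurable h ->
  (\forall x \ae mu, circle R x -> normc (h x) `^ alpha <= B) ->
  mu.-integrable (circle R) (EFin \o (fun x => normc (h x) `^ alpha * w x)).
Proof.
move=> a0 [w0 wi] mh hB; have mw := integrable_mfun wi.
have mm : measurable_fun (circle R) (fun x => normc (h x) `^ alpha * w x).
  by apply: measurable_funM => //; exact: measurable_normc_powR.
apply: ge0_integrable => //.
  by move=> x cx; rewrite mulr_ge0 ?powR_ge0 ?w0.
apply: (@le_lt_trans _ _ (\int[mu]_(x in circle R) (`|B| * w x)%:E)%E).
  apply: ae_le_circle_integral => //.
  - exact: measurable_funM.
  - by move=> x cx; rewrite mulr_ge0 ?powR_ge0 ?w0.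
  - by move=> x cx; rewrite mulr_ge0 ?w0.
  apply: ae_imply hB => x H cx; rewrite ler_wpM2r ?w0//.
  by apply: le_trans (H cx) _; exact: ler_norm.
exact: circle_integral_lty (circle_integrableZ `|B| wi).
Qed.

Lemma Lminus_bounded (alpha B : R) w h : 1 <= alpha -> spectral_density w ->
  cmeasurable h -> (\forall x \ae mu, circle R x -> normc (h x) `^ alpha <= B) ->
  (forall k : nat, cintegral (fun x => expi (- (x * k%:R)) * h x) = 0) ->
  Lminus alpha w h.
Proof.
move=> a1 dw mh hB h0; have a0 : 0 < alpha by lra.
(* Either [|h| <= 1], or [|h| <= |h|^alpha <= B]. *)
have hB' : \forall x \ae mu, circle R x -> normc (h x) <= 1 + `|B|.
  apply: ae_imply hB => x H cx; have [h1|h1] := leP (normc (h x)) 1.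
    by rewrite (le_trans h1)// lerDl.
  apply: le_trans (le1r_powR (ltW h1) a1) _.
  by apply: le_trans (H cx) _; apply: le_trans (ler_norm _) _; rewrite lerDr.
have ih := ae_bounded_cintegrable mh hB'.
split=> //.
  by apply: poweR_lty; exact: circle_integral_lty (bounded_integrable_weight (ltW a0) dw mh hB).
move=> e e0.
(* The accuracy is [e^alpha] because [weighted_norm] takes the root of order [alpha] of the
   integral. *)
have [n Hn] := fejer_mean_weighted a1 dw mh hB' (powR_gt0 alpha e0).
have [m [c E]] := is_neg_trig_fejer_mean n ih h0.
exists m, c; apply: (weighted_norm_lt a0 dw e0).
by under eq_integral do rewrite -E.
Qed.

End NegativeFrequencies.

(** * Convexity and orthogonality *)

Section PowerConvexity.
Variable R : realType.
Implicit Types (alpha : R) (y z : R[i]).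

(** The graph of [t^alpha] lies above its tangent at [r]. It is Young's inequality for [s] and
    [r^(alpha-1)] with exponents [alpha] and [alpha / (alpha - 1)], multiplied by [alpha]. *)
Lemma powR_tangent alpha (r s : R) : 1 < alpha -> 0 <= r -> 0 <= s ->
  alpha * (s * r `^ (alpha - 1)) <= s `^ alpha + (alpha - 1) * r `^ alpha.
Proof.
move=> alpha1.
move=> r0 s0; have a0 : 0 < alpha by lra.
have b0 : 0 < alpha - 1 by lra.
have q0 : 0 < alpha / (alpha - 1) by rewrite divr_gt0.
have an : alpha != 0 by rewrite gt_eqF.
have bn : alpha - 1 != 0 by rewrite gt_eqF.
have pq : alpha^-1 + (alpha / (alpha - 1))^-1 = 1.
  by field; rewrite bn an.
have := conjugate_powR s0 (powR_ge0 r (alpha - 1)) a0 q0 pq.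
rewrite -powRrM (_ : (alpha - 1) * (alpha / (alpha - 1)) = alpha); last first.
  by field; exact: bn.
rewrite -(ler_pM2l a0) => /le_trans; apply.
rewrite le_eqVlt; apply/orP; left; apply/eqP; field.
by rewrite bn an.
Qed.

Lemma normc_signed_pow alpha z : 1 < alpha ->
  normc (signed_pow z (alpha - 1)) = normc z `^ (alpha - 1).
Proof.
move=> alpha1.
rewrite /signed_pow normcM normc_conj normc_real ger0_norm ?powR_ge0// mulrC.
by rewrite mulr_powRB1 ?normc_ge0// subr_gt0.
Qed.

(** Turns an essential bound on [|z|^alpha] into one on the signed power in the equation for [C0];
    compare the powers separately for [|z| <= 1] and [|z| > 1]. *)
Lemma normc_signed_pow_le alpha z : 1 < alpha ->
  normc (signed_pow z (alpha - 1)) <= 1 + normc z `^ alpha.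
Proof.
move=> alpha1.
rewrite normc_signed_pow//; have [z1|z1] := leP (normc z) 1.
  apply: (@le_trans _ _ 1); last by rewrite lerDl powR_ge0.
  rewrite [leRHS](_ : 1 = 1 `^ (alpha - 1)); last by rewrite powR1.
  by apply: ge0_ler_powR z1; rewrite ?nnegrE ?normc_ge0// subr_ge0 ltW.
apply: (@le_trans _ _ (normc z `^ alpha)); last by rewrite lerDr.
by apply: ler_powR; [exact: ltW|lra].
Qed.

(** The signed power, paired through the real part, is the gradient of [|z|^alpha] up to the factor
    [alpha]. Bounding [Re (conj z * y)] by [|z| |y|] reduces the claim to the real tangent
    inequality at [|z|]. *)
Lemma powR_normc_convex alpha z y : 1 < alpha ->
  normc z `^ alpha + alpha * complex.Re (signed_pow z (alpha - 1) * (y - z)) <=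
  normc y `^ alpha.
Proof.
move=> alpha1.
set r := normc z; set s := normc y.
have r0 : 0 <= r := normc_ge0 z; have s0 : 0 <= s := normc_ge0 y.
have H1 : complex.Re (conjc z * (y - z)) <= r * s - r ^+ 2.
  rewrite mulrBr ReD ReN; apply: lerB.
    apply: le_trans (ler_norm _) _; apply: le_trans (normc_Re _) _.
    by rewrite normcM normc_conj.
  by rewrite mulrC -normc_sqr.
have H2 : complex.Re (signed_pow z (alpha - 1) * (y - z)) <=
    s * r `^ (alpha - 1) - r `^ alpha.
  rewrite /signed_pow -mulrA ReM /= mul0r subr0 -/r.
  apply: le_trans (ler_wpM2l (powR_ge0 _ _) H1) _.
  rewrite -[r `^ alpha](mulr_powRB1 r0); last by lra.
  rewrite -[r `^ (alpha - 1)](mulr_powRB1 r0) ?subr_gt0//.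
  by rewrite le_eqVlt; apply/orP; left; apply/eqP; ring.
have H3 := powR_tangent alpha1 r0 s0.
have a0 : 0 <= alpha by lra.
have := ler_wpM2l a0 H2.
by lra.
Qed.

(** If [t > d], then [(t / d)^(alpha-1) >= 1] and the second term alone exceeds [t]. The parameter
    [d] stays free so that it can later be matched to an approximation error. *)
Lemma le_young_small alpha (d t : R) : 1 < alpha -> 0 < d -> 0 <= t ->
  t <= d + d `^ (1 - alpha) * t `^ alpha.
Proof.
move=> alpha1.
move=> d0 t0; have [td|dt] := leP t d.
  by rewrite (le_trans td)// lerDl mulr_ge0 ?powR_ge0.
have t0' : 0 < t := lt_trans d0 dt.
apply: (@le_trans _ _ (d `^ (1 - alpha) * t `^ alpha)); last first.
  by rewrite lerDr ltW.
rewrite [leLHS](_ : t = t `^ (1 - alpha) * t `^ alpha); last first.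
  by rewrite -powRD ?(gt_eqF t0') ?implybT// subrK powRr1.
rewrite ler_wpM2r ?powR_ge0//.
have -> : 1 - alpha = - (alpha - 1) by ring.
rewrite !powRN lef_pV2 ?posrE ?powR_gt0//.
by apply: ge0_ler_powR (ltW dt); rewrite ?nnegrE ?(ltW d0)// subr_ge0 ltW.
Qed.

End PowerConvexity.

Section Orthogonality.
Variable R : realType.
Implicit Types (w : R -> R) (h C p : R -> R[i]).
Let mu := @lebesgue_measure R.

Lemma cmeasurable_conjc h : cmeasurable h -> cmeasurable (fun x => conjc (h x)).
Proof.
move=> [h1 h2]; split.
- by rewrite (_ : (fun x => _) = fun x => complex.Re (h x))//; apply/funext => x; case: (h x).
- rewrite (_ : (fun x => _) = fun x => - complex.Im (h x)); first exact: measurableT_comp.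
  by apply/funext => x; case: (h x).
Qed.

Lemma cintegral_conjc h : cintegrable h ->
  cintegrable (fun x => conjc (h x)) /\
  cintegral (fun x => conjc (h x)) = conjc (cintegral h).
Proof.
move=> [h1 h2].
have E1 : (fun x => complex.Re (conjc (h x))) = fun x => complex.Re (h x).
  by apply/funext => x; case: (h x).
have E2 : (fun x => complex.Im (conjc (h x))) = fun x => - 1 * complex.Im (h x).
  by apply/funext => x; case: (h x) => a b; rewrite mulN1r.
split; first split.
- by rewrite -[X in _.-integrable _ X]/(EFin \o (fun x => complex.Re (conjc (h x)))) E1.
- rewrite -[X in _.-integrable _ X]/(EFin \o (fun x => complex.Im (conjc (h x)))) E2.
  exact: circle_integrableZ.
- by rewrite /cintegral E1 E2 RintegralZl//= mulN1r.
Qed.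

(** Since [e^(-i(k+1)x) * conj C] is the conjugate of [e^(i(k+1)x) * C], its integral is, up to the
    factor [2 pi] and conjugation, the Fourier coefficient of [C] at [-(k+1)], which vanishes. *)
Lemma neg_trig_orthogonal n d C (c : nat -> R[i]) : analytic_series C c ->
  cintegrable (fun x => neg_trig n d x * conjc (C x)) /\
  cintegral (fun x => neg_trig n d x * conjc (C x)) = 0.
Proof.
move=> [iC _ C0].
have iE (k : nat) : cintegrable (fun x => expi (k.+1%:R * x) * C x).
  exact: cintegrable_expiM.
have E : (fun x => neg_trig n d x * conjc (C x)) =
    fun x => \sum_(k < n) d k * conjc (expi (k.+1%:R * x) * C x).
  apply/funext => x; rewrite /neg_trig mulr_suml; apply: eq_bigr => k _.
  by rewrite -mulrA rmorphM /= -conjc_expi.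
rewrite E; split.
  apply: cintegrable_sum => k; apply: cintegrableZ.
  by have [] := cintegral_conjc (iE k).
rewrite cintegral_sum; last first.
  by move=> k; apply: cintegrableZ; have [] := cintegral_conjc (iE k).
rewrite big1// => k _; have [i1 i2] := cintegral_conjc (iE k).
rewrite cintegralZ// i2.
have := C0 k; rewrite /fourier_coef.
have -> : (fun x => C x * expi (- ((- (k.+1)%:Z)%:~R * x))) =
    fun x => expi (k.+1%:R * x) * C x.
  apply/funext => x; rewrite mulrC; congr (expi _ * _).
  by rewrite mulrNz mulNr opprK.
move=> /eqP; rewrite mulf_eq0 => /orP[|/eqP ->]; last by rewrite conjc0 mulr0.
rewrite eq_complex /= => /andP[/eqP H _].
have := pi_gt0 R; have : 0 < (2 * pi)^-1 :> R by rewrite invr_gt0 mulr_gt0// pi_gt0.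
by rewrite H ltxx.
Qed.

(** Absolute summability makes both component series converge at every point, so each is a pointwise
    limit of measurable partial sums. *)
Lemma cmeasurable_boundary_fun (a : nat -> R[i]) :
  cvgn (series (fun j => normc (a j))) -> cmeasurable (boundary_fun a).
Proof.
move=> ca.
have mterm j : cmeasurable (fun x => a j * expi (j%:R * x)).
  apply: cintegrable_cmeasurable; apply: cintegrableZ; exact: cintegrable_expi.
have dom (u : nat -> R) : (forall j, `|u j| <= normc (a j)) -> cvgn (series u).
  move=> ua; apply: normed_cvg; apply: series_le_cvg ca => //= j; exact: normc_ge0.
split.
- apply: (@measurable_fun_cvg _ _ R (circle R) (fun m x =>
    series (fun j => complex.Re (a j * expi (j%:R * x))) m)
    (fun x => complex.Re (boundary_fun a x))).
    move=> m; rewrite /series /=; apply: measurable_sum => j.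
    by have [] := mterm j.
  move=> x _; apply: dom => j; apply: le_trans (normc_Re _) _.
  by rewrite normcM normc_expi mulr1.
- apply: (@measurable_fun_cvg _ _ R (circle R) (fun m x =>
    series (fun j => complex.Im (a j * expi (j%:R * x))) m)
    (fun x => complex.Im (boundary_fun a x))).
    move=> m; rewrite /series /=; apply: measurable_sum => j.
    by have [] := mterm j.
  move=> x _; apply: dom => j; apply: le_trans (normc_Im _) _.
  by rewrite normcM normc_expi mulr1.
Qed.

End Orthogonality.

(** * Orthogonality on the closed subspace and optimality *)

Section Optimality.
Variable R : realType.
Implicit Types (f g w : R -> R) (A h C p : R -> R[i]) (alpha K : R).
Let mu := @lebesgue_measure R.

Lemma spectral_densityD f g : spectral_density f -> spectral_density g ->
  spectral_density (fun x => f x + g x).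
Proof.
move=> [f0 fi] [g0 gi]; split.
  by move=> x cx; rewrite addr_ge0 ?f0 ?g0.
exact: (integrableD _ fi gi).
Qed.

(** Plays the role of Hoelder's inequality: bound [|C|] by [K * w] and [|h|] by
    [d + d^(1-alpha) * |h|^alpha], then integrate. *)
Lemma integral_Re_conjc_le alpha K (d : R) w h C : 1 < alpha -> 0 <= K -> 0 < d ->
  spectral_density w -> cmeasurable h -> cmeasurable C ->
  (\forall x \ae mu, circle R x -> normc (C x) <= K * w x) ->
  (\int[mu]_(x in circle R) (`|complex.Re (h x * conjc (C x))|)%:E <=
   (K * d)%:E * (\int[mu]_(x in circle R) (w x)%:E) +
   (K * d `^ (1 - alpha))%:E *
     \int[mu]_(x in circle R) (normc (h x) `^ alpha * w x)%:E)%E.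
Proof.
move=> a1 K0 d0 [w0 wi] mh mC CK; have mw := integrable_mfun wi.
have mp : measurable_fun (circle R) (fun x => normc (h x) `^ alpha * w x).
  by apply: measurable_funM => //; exact: measurable_normc_powR.
have p0 x : circle R x -> 0 <= normc (h x) `^ alpha * w x.
  by move=> cx; rewrite mulr_ge0 ?powR_ge0 ?w0.
have Kd : 0 <= K * d by rewrite mulr_ge0// ltW.
have Kda : 0 <= K * d `^ (1 - alpha) by rewrite mulr_ge0// powR_ge0.
rewrite -circle_integralZ// -circle_integralZ// -circle_integralD//; last 4 first.
- exact: measurable_funM.
- exact: measurable_funM.
- by move=> x cx; rewrite mulr_ge0// w0.
- by move=> x cx; rewrite mulr_ge0// p0.
apply: ae_le_circle_integral => //.
- apply: (measurableT_comp (@normr_measurable R setT)).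
  by have [] := cmeasurableM mh (cmeasurable_conjc mC).
- by apply: measurable_funD; exact: measurable_funM.
- by move=> x cx; rewrite addr_ge0// mulr_ge0 ?w0 ?p0.
apply: ae_imply CK => x H cx; apply: le_trans (normc_Re _) _.
rewrite normcM normc_conj.
have H1 := le_young_small a1 d0 (normc_ge0 (h x)).
apply: le_trans (ler_pM (normc_ge0 _) (normc_ge0 _) H1 (H cx)) _.
by rewrite le_eqVlt; apply/orP; left; apply/eqP; ring.
Qed.

Lemma Lminus_orthogonal alpha K w h C (c : nat -> R[i]) : 1 < alpha -> 0 <= K ->
  spectral_density w -> Lminus alpha w h -> analytic_series C c ->
  (\forall x \ae mu, circle R x -> normc (C x) <= K * w x) ->
  mu.-integrable (circle R) (EFin \o (fun x => complex.Re (h x * conjc (C x)))) /\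
  \int[mu]_(x in circle R) complex.Re (h x * conjc (C x)) = 0.
Proof.
move=> a1 K0 dw [mh hfin happ] aC CK; have [w0 wi] := dw.
have a0 : 0 < alpha by lra.
have iC : cintegrable C by have [] := aC.
have mC := cintegrable_cmeasurable iC.
have mphi p : cmeasurable p ->
    measurable_fun (circle R) (fun x => complex.Re (p x * conjc (C x))).
  by move=> mp; have [] := cmeasurableM mp (cmeasurable_conjc mC).
have Wfin := circle_integral_fin_num wi.
have jfin : (\int[mu]_(x in circle R) (normc (h x) `^ alpha * w x)%:E < +oo)%E.
  by apply: lty_poweRy hfin; rewrite invr_neq0 ?gt_eqF.
have hi : mu.-integrable (circle R) (EFin \o (fun x => complex.Re (h x * conjc (C x)))).
  apply/integrableP; split; first by apply/measurable_EFinP; exact: mphi.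
  apply: le_lt_trans (integral_Re_conjc_le a1 K0 ltr01 dw mh mC CK) _.
  apply: lte_add_pinfty.
    by rewrite -(fineK Wfin) -EFinM ltry.
  by apply: lte_mul_pinfty => //; rewrite lee_fin mulr_ge0// powR_ge0.
split=> //; apply/eqP; rewrite -normr_le0; apply/ler_addgt0Pl => e e0; rewrite addr0.
pose W := fine (\int[mu]_(x in circle R) (w x)%:E)%E.
have W0 : 0 <= W by rewrite fine_ge0// integral_ge0// => x cx; rewrite lee_fin w0.
(* At accuracy [d] the two terms of the bound are [K * d * W] and [K * d], in total
   [d * (K * (W + 1))]; the final [+ 1] keeps the denominator positive when [K = 0]. *)
pose d := e / (K * (W + 1) + 1).
have D0 : 0 < K * (W + 1) + 1 by rewrite ltr_wpDl// mulr_ge0// addr_ge0.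
have d0 : 0 < d by rewrite divr_gt0.
have [n [b Hb]] := happ d d0.
have mp : cmeasurable (neg_trig n b) := cmeasurable_neg_trig n b.
have mhp : cmeasurable (fun x => h x - neg_trig n b x) by exact: cmeasurableB.
have [[pi1 _] pi2] := neg_trig_orthogonal n b aC.
have HJ := integral_weighted_lt a0 dw d0 Hb.
have pz : \int[mu]_(x in circle R) complex.Re (neg_trig n b x * conjc (C x)) = 0.
  exact: (congr1 (@complex.Re R) pi2).
have E : \int[mu]_(x in circle R) complex.Re (h x * conjc (C x)) =
    \int[mu]_(x in circle R) complex.Re ((h x - neg_trig n b x) * conjc (C x)).
  rewrite -[LHS]subr0 -[X in _ - X]pz -RintegralB//.
  by apply: eq_Rintegral => x _; rewrite mulrBl ReD ReN.
have ihp : mu.-integrable (circle R)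
    (EFin \o (fun x => complex.Re ((h x - neg_trig n b x) * conjc (C x)))).
  have := integrableB (mu := mu) (@measurable_circle R) hi pi1.
  by apply: eq_integrable => // x _; rewrite /= mulrBl ReD ReN.
rewrite E; apply: le_trans (le_normr_Rintegral _ ihp) _ => //.
have ianp := integrable_norm ihp.
rewrite -lee_fin /Rintegral fineK; last exact: circle_integral_fin_num.
apply: le_trans (integral_Re_conjc_le a1 K0 d0 dw mhp mC CK) _.
apply: (@le_trans _ _ ((K * d)%:E * W%:E + (K * d `^ (1 - alpha))%:E * (d `^ alpha)%:E)%E).
  rewrite /W fineK//; apply: leeD2l; apply: lee_wpmul2l; last exact: ltW.
  by rewrite lee_fin mulr_ge0// powR_ge0.
rewrite -!EFinM -EFinD lee_fin.
have -> : K * d `^ (1 - alpha) * d `^ alpha = K * d.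
  by rewrite -mulrA -powRD ?(gt_eqF d0) ?implybT// subrK powRr1// ltW.
have -> : K * d * W + K * d = d * (K * (W + 1)) by ring.
rewrite /d mulrAC ler_pdivrMr// ler_pM2l//.
by rewrite lerDl.
Qed.

Lemma optimal_of_orthogonal alpha (M1 M2 : R) A f g h0 C (c : nat -> R[i]) :
  1 < alpha -> cmeasurable A -> spectral_density f -> spectral_density g ->
  Lminus alpha (fun x => f x + g x) h0 -> analytic_series C c ->
  (\forall x \ae mu, circle R x ->
     signed_pow (A x - h0 x) (alpha - 1) * (f x)%:C -
     signed_pow (h0 x) (alpha - 1) * (g x)%:C = conjc (C x)) ->
  (\forall x \ae mu, circle R x -> normc (A x - h0 x) `^ alpha <= M1) ->
  (\forall x \ae mu, circle R x -> normc (h0 x) `^ alpha <= M2) ->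
  optimal alpha A f g h0.
Proof.
move=> a1 mA df dg L0 aC eqC AM hM; have [f0 fi] := df; have [g0 gi] := dg.
have mf := integrable_mfun fi; have mg := integrable_mfun gi.
split; [exact: L0|move=> h Lh]; have dw := spectral_densityD df dg.
have mh0 : cmeasurable h0 by have [] := L0.
have mh : cmeasurable h by have [] := Lh.
(* The two signed powers have moduli at most [1 + M1] and [1 + M2]; [K] exceeds both and, thanks to
   the absolute values, is nonnegative. *)
pose K := 1 + `|M1| + `|M2|.
have K0 : 0 <= K by rewrite !addr_ge0.
have CK : \forall x \ae mu, circle R x -> normc (C x) <= K * (f x + g x).
  apply: ae_imply2 eqC _; last first.
    exact: (ae_imply2 (fun x P Q => conj P Q) AM hM).
  move=> x E [H1 H2] cx; rewrite -normc_conj -(E cx).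
  have := normc_signed_pow_le (A x - h0 x) a1; have := normc_signed_pow_le (h0 x) a1.
  move: (signed_pow _ _) (signed_pow _ _) => S2 S1 S2le S1le.
  apply: le_trans (normcD _ _) _; rewrite normcN !normcM !normc_real.
  rewrite (ger0_norm (f0 _ cx)) (ger0_norm (g0 _ cx)) mulrDr.
  have := H1 cx; have := H2 cx.
  have := ler_norm M1; have := ler_norm M2; have := normr_ge0 M1; have := normr_ge0 M2.
  move=> ? ? ? ? ? ?; apply: lerD; apply: ler_wpM2r; rewrite ?f0 ?g0// /K; lra.
have [i1 z1] := Lminus_orthogonal a1 K0 dw L0 aC CK.
have [i2 z2] := Lminus_orthogonal a1 K0 dw Lh aC CK.
(* The first-order term of the error in the direction [h0 - h]; its integral is zero because [C]
   annihilates both functions. *)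
pose psi x := alpha * (complex.Re (h0 x * conjc (C x)) - complex.Re (h x * conjc (C x))).
have ipsi' : mu.-integrable (circle R) (EFin \o (fun x =>
    complex.Re (h0 x * conjc (C x)) - complex.Re (h x * conjc (C x)))).
  exact: (integrableB _ i1 i2).
have ipsi : mu.-integrable (circle R) (EFin \o psi) by exact: circle_integrableZ.
have zpsi : \int[mu]_(x in circle R) psi x = 0.
  by rewrite RintegralZl// RintegralB// z1 z2 subrr mulr0.
have mpsi := integrable_mfun ipsi.
have iapsi := integrable_norm ipsi.
have mapsi : measurable_fun (circle R) (fun x => `|psi x|) := integrable_mfun iapsi.
pose e0 x := normc (A x - h0 x) `^ alpha * f x + normc (h0 x) `^ alpha * g x.
pose e1 x := normc (A x - h x) `^ alpha * f x + normc (h x) `^ alpha * g x.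
have m1 k : cmeasurable k ->
    measurable_fun (circle R) (fun x => normc (A x - k x) `^ alpha * f x).
  move=> mk; apply: measurable_funM => //; apply: measurable_normc_powR.
  exact: cmeasurableB.
have m2 k : cmeasurable k ->
    measurable_fun (circle R) (fun x => normc (k x) `^ alpha * g x).
  by move=> mk; apply: measurable_funM => //; exact: measurable_normc_powR.
have p1 k x : circle R x -> 0 <= normc (A x - k x) `^ alpha * f x.
  by move=> cx; rewrite mulr_ge0 ?powR_ge0 ?f0.
have p2 k x : circle R x -> 0 <= normc (k x) `^ alpha * g x.
  by move=> cx; rewrite mulr_ge0 ?powR_ge0 ?g0.
have errE k : cmeasurable k -> (error alpha A k f g = \int[mu]_(x in circle R)
    (normc (A x - k x) `^ alpha * f x + normc (k x) `^ alpha * g x)%:E)%E.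
  move=> mk; rewrite circle_integralD//.
  - exact: m1.
  - exact: m2.
  - by move=> x; exact: p1.
  - by move=> x; exact: p2.
rewrite (errE _ mh0) (errE _ mh).
have me0 : measurable_fun (circle R) e0.
  by apply: measurable_funD; [exact: m1|exact: m2].
have me1 : measurable_fun (circle R) e1.
  by apply: measurable_funD; [exact: m1|exact: m2].
have e00 x : circle R x -> 0 <= e0 x by move=> cx; rewrite addr_ge0 ?p1 ?p2.
have e10 x : circle R x -> 0 <= e1 x by move=> cx; rewrite addr_ge0 ?p1 ?p2.
(* [psi] has no sign, so [|psi|] is added to both sides: all integrands become nonnegative and the
   extended integrals split without prior knowledge that the error at [h] is finite. The integral of
   [|psi|] is finite and cancels at the end. *)
have key : \forall x \ae mu, circle R x -> e0 x + (`|psi x| + psi x) <= e1 x + `|psi x|.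
  apply: ae_imply eqC => x E cx.
  (* The displacement from [A - h0] to [A - h] is [h0 - h], and from [h0] to [h] it is the opposite;
     weighting by [f] and [g] and adding therefore recreates the difference that the equation
     identifies with [conj C]. *)
  have H1 := powR_normc_convex (A x - h0 x) (A x - h x) a1.
  have H2 := powR_normc_convex (h0 x) (h x) a1.
  have := ler_wpM2r (f0 _ cx) H1; have := ler_wpM2r (g0 _ cx) H2.
  have -> : psi x = alpha * complex.Re ((h0 x - h x) * conjc (C x)).
    by rewrite /psi mulrBl ReD ReN.
  rewrite -(E cx).
  have -> : A x - h x - (A x - h0 x) = h0 x - h x by ring.
  have -> : h x - h0 x = - (h0 x - h x) by ring.
  set D := h0 x - h x; set S1 := signed_pow (A x - h0 x) _; set S2 := signed_pow (h0 x) _.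
  have -> : complex.Re (D * (S1 * (f x)%:C - S2 * (g x)%:C)) =
      complex.Re (S1 * D) * f x - complex.Re (S2 * D) * g x.
    by rewrite !(ReM, ImM, ReD, ImD, ReN, ImN) /=; ring.
  have -> : complex.Re (S2 * - D) = - complex.Re (S2 * D) by rewrite mulrN ReN.
  rewrite /e0 /e1; lra.
have pospsi x : circle R x -> 0 <= `|psi x| + psi x.
  by move=> _; have := ler_norm (- psi x); rewrite normrN; lra.
have mpp : measurable_fun (circle R) (fun x => `|psi x| + psi x) by exact: measurable_funD.
have : (\int[mu]_(x in circle R) (e0 x + (`|psi x| + psi x))%:E <=
        \int[mu]_(x in circle R) (e1 x + `|psi x|)%:E)%E.
  apply: ae_le_circle_integral => //.
  - exact: measurable_funD.
  - exact: measurable_funD.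
  - by move=> x cx; rewrite addr_ge0 ?e00 ?pospsi.
  - by move=> x cx; rewrite addr_ge0 ?e10.
have apsi0 x : circle R x -> 0 <= `|psi x| by [].
rewrite (circle_integralD me0 mpp e00 pospsi) (circle_integralD me1 mapsi e10 apsi0).
have -> : (\int[mu]_(x in circle R) (`|psi x| + psi x)%:E =
    \int[mu]_(x in circle R) (`|psi x|)%:E)%E.
  have i3 : mu.-integrable (circle R) (EFin \o (fun x => `|psi x| + psi x)).
    exact: (integrableD _ iapsi ipsi).
  rewrite -[LHS]fineK; last exact: circle_integral_fin_num.
  rewrite -[RHS]fineK; last exact: circle_integral_fin_num.
  congr EFin; have := RintegralD (mu := mu) (@measurable_circle R) iapsi ipsi.
  by rewrite zpsi addr0.
by rewrite leeD2rE//; exact: circle_integral_fin_num.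
Qed.

End Optimality.

(** * The saddle point and its consequences *)

Unset Implicit Arguments.
Theorem theorem4 (R : realType) (alpha : R) (a : nat -> R[i])
  (beta P1 P2 eps : R) (g1 f0 g0 : R -> R)
  (h0 C0 : R -> R[i]) (c : nat -> R[i])
  (gamma1 gamma2 : R) (phi1 : R -> R) :
  let mu := @lebesgue_measure R in
  let A := boundary_fun a in
  let D := class_power beta P1 `*` class_contaminated eps P2 g1 in
  1 < alpha <= 2 ->
  cvgn (series (fun j => normc (a j))) ->
  cvgn (series (fun j => (j.+1)%:R * normc (a j) ^+ 2)) ->
  0 < eps < 1 ->
  spectral_density g1 ->
  class_power beta P1 f0 ->
  class_contaminated eps P2 g1 g0 ->
  (\forall x \ae mu, circle R x -> 0 < f0 x /\ 0 < g0 x) ->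
  (\int[mu]_(x in circle R) epow (f0 x + g0 x)%R (- (alpha - 1)^-1)%R
     < +oo)%E ->
  cmeasurable h0 ->
  analytic_series C0 c ->
  (\forall x \ae mu, circle R x ->
     signed_pow (A x - h0 x) (alpha - 1) * (f0 x)%:C -
     signed_pow (h0 x) (alpha - 1) * (g0 x)%:C = conjc (C0 x)) ->
  (forall k : nat, cintegral (fun x => expi (- (x * k%:R)) * h0 x) = 0) ->
  (exists M : R, \forall x \ae mu, circle R x ->
     normc (A x - h0 x) `^ alpha <= M) ->
  (exists M : R, \forall x \ae mu, circle R x -> normc (h0 x) `^ alpha <= M) ->
  (\forall x \ae mu, circle R x ->
     normc (A x - h0 x) `^ alpha = gamma1 * f0 x `^ (beta - 1)) ->
  (\forall x \ae mu, circle R x -> normc (h0 x) `^ alpha = phi1 x + gamma2) ->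
  (\forall x \ae mu, circle R x -> phi1 x <= 0) ->
  (\forall x \ae mu, circle R x -> (1 - eps) * g1 x < g0 x -> phi1 x = 0) ->
  is_max (errors alpha A D h0) (error alpha A h0 f0 g0) ->
  [/\ optimal alpha A f0 g0 h0,
      least_favorable alpha A D f0 g0 &
      minimax alpha A D h0].
Proof.
move=> mu A D /andP[a1 _] ca _ _ dg1 Df Dg _ _ mh0 aC eqC h0z [M1 AM] [M2 hM] _ _ _ _ [_ maxh].
have a1' := ltW a1.
have mA : cmeasurable A := cmeasurable_boundary_fun ca.
have df : spectral_density f0 by case: Df.
have dg : spectral_density g0 by case: Dg.
have HL f g : D (f, g) -> Lminus alpha (fun x => f x + g x) h0.
  move=> [/= [df' _] [dg' _ _]].
  apply: Lminus_bounded => //; last exact: hM.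
  exact: spectral_densityD.
have D0 : D (f0, g0) by split.
have opt : optimal alpha A f0 g0 h0.
  exact: (optimal_of_orthogonal a1 mA df dg (HL _ _ D0) aC eqC AM hM).
have in_errors f g : D (f, g) -> errors alpha A D h0 (error alpha A h0 f g).
  by move=> Dfg; exists (f, g).
split=> //.
- split=> //; exists h0 => //; split; first by exists f0, g0, h0.
  move=> _ [f [g [h [Dfg [_ hopt] ->]]]].
  (* [h0] is itself a competitor for this pair, so the optimal [h] does at least as well there. *)
  apply: le_trans (hopt _ (HL _ _ Dfg)) _.
  exact/maxh/in_errors.
- split; first exact: HL.
  exists (error alpha A h0 f0 g0).
    by split; first exact: in_errors.
  (* The single pair [(f0, g0)] bounds the supremum from below, and every [h] in [H_class] is
     admissible for it. *)
  move=> h Hh; apply: (@le_trans _ _ (error alpha A h f0 g0)).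
    by have [_] := opt; apply; exact: Hh.
  by apply: ereal_sup_ubound; exists (f0, g0).
Qed.
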